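(* Let $(\mu,\nu)\in\boldsymbol{\mathcal P}$ and let $\varphi\in C([0,1],\mathcal P([0,1]))$ be monotonic, i.e. $\varphi(s)\le_{st}\varphi(t)$ whenever $0\le s\le t\le1$. Let $G^\varphi_{(\mu,\nu)}$ be the unique continuous map $G:\mathbb S\to\mathcal P([0,1])$ satisfying, for all $(x,y)\in\mathbb S$, $$x\int_0^\beta \big(G(x,y)-G(x+k,y)\big)\mu(dk)+y\int_0^\beta\big(G(x,y)-G(x,y+k)\big)\nu(dk)=0,$$ $G(0,y)=\varphi(0)$, $G(x,0)=\varphi(1)$, and $d_W\big(G(x,y),\varphi(\tfrac{x}{x+y})\big)\to0$ as $x+y\to\infty$. Let $\Phi=\int_0^1\varphi(t)\,dt$, i.e. $\Phi(B)=\int_0^1\varphi(t)(B)\,dt$ for Borel $B\subseteq[0,1]$. Then: (1) if there is $(x_0,y_0)$ with $x_0>0,y_0>0$ such that $G^\varphi_{(\mu,\nu)}(x_0,y_0)$ has no point masses in $[0,1]$, then $\Phi$ has no point masses in $[0,1]$; (2) if $\Phi$ has no point masses in $[0,1]$, then $G^\varphi_{(\mu,\nu)}(x,y)$ has no point masses in $[0,1]$ for all $x>0,y>0$.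
   Context: $\mathcal P([0,\beta])$: Borel probability measures on $[0,\beta]$ with 1-Wasserstein metric $d_W$. Fix $0<m_0\le\beta<\infty$. $\boldsymbol{\mathcal P}$: pairs $(\mu,\nu)$ of probability measures on $[0,\beta]$ with equal means $\int k\,\mu(dk)=\int k\,\nu(dk)\ge m_0$. $\mathbb S=[0,\infty)^2\setminus\{(0,0)\}$. $\varphi:[0,1]\to(\mathcal P([0,1]),d_W)$ continuous (a boundary datum); existence and uniqueness of $G^\varphi_{(\mu,\nu)}$ is part of the setting. $\le_{st}$ is the usual stochastic order: $\xi_1\le_{st}\xi_2$ iff $F_{\xi_1}(z)\ge F_{\xi_2}(z)$ for all $z$. The functional equation is an identity of signed measures. *)

(* Defs.v *)
From HB Require Import structures.
From mathcomp Require Import all_boot all_order all_algebra.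
From mathcomp Require Import all_classical all_reals all_analysis.
Set Implicit Arguments. Unset Strict Implicit. Unset Printing Implicit Defensive.
Import Order.TTheory GRing.Theory Num.Theory.
Import numFieldNormedType.Exports.
Local Open Scope classical_set_scope.
Local Open Scope ring_scope.

(* A Borel probability measure on [0,a] is represented as a probability
   measure on R (Borel sets) giving full mass to [0,a]. *)
Definition supported_on {R : realType} (a : R) (m : probability R R) : Prop :=
  m [set` `[0, a]%classic] = 1%E.

Definition coupling {R : realType} (m n : probability R R)
  (p : probability (R * R)%type R) : Prop :=
  forall A : set R, measurable A ->
    p (fst @^-1` A) = m A /\ p (snd @^-1` A) = n A.

Definition dW {R : realType} (m n : probability R R) : \bar R :=
  ereal_inf [set (\int[p]_z (`| z.1 - z.2 |)%:E)%E | p in coupling m n].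

Definition cdf {R : realType} (m : probability R R) (z : R) : \bar R :=
  m [set` `]-oo, z]%classic].

Definition st_le {R : realType} (m n : probability R R) : Prop :=
  forall z : R, (cdf n z <= cdf m z)%E.

Definition no_atoms01 {R : realType} (m : set R -> \bar R) : Prop :=
  forall z : R, 0 <= z <= 1 -> m [set z] = 0%E.

Definition inS {R : realType} (x y : R) : Prop :=
  0 <= x /\ 0 <= y /\ (x, y) <> (0, 0).

Definition Phi_of {R : realType} (phi : R -> probability R R) (B : set R) : \bar R :=
  (\int[lebesgue_measure]_(t in `[0%R, 1%R]) phi t B)%E.

(* Main.v *)
Require Import Defs.
From HB Require Import structures.
From mathcomp Require Import all_boot all_order all_algebra.
From mathcomp Require Import all_classical all_reals all_analysis.
From mathcomp Require Import measurable_realfun ring lra.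
Import Order.TTheory GRing.Theory Num.Theory.
Import numFieldNormedType.Exports.
Local Open Scope classical_set_scope.
Local Open Scope ring_scope.

(** Fix [z] and put [u(x,y) = G(x,y){z}], [f(t) = phi(t)(-oo,z]],
    [g(t) = phi(t)(-oo,z[].  Both [f] and [g] are nonincreasing, and
    [Phi{z} = 0] holds if and only if [f(t) <= g(t')] whenever [t' < t].

    Under this gap condition, compare the urn with colours [(x,e,y)] after
    giving the extra colour [e] to the first or to the second component: since
    every colour keeps a positive fraction at infinity, the maximum principle
    gives [G(x+e,y)(-oo,z] <= G(x,y)(-oo,z[], and likewise in [y].  Hence the
    atoms along a row or a column add up to at most 1.  But near a point where
    the harmonic function [u] almost attains its positive supremum one can jump
    arbitrarily often along the row or the column without losing more than half
    of the supremum, so [u = 0].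

    If the gap condition fails, [phi(t){z} >= c > 0] on an interval, and a
    second-moment barrier yields [u > 0] far away near that direction.  Zeros of
    the nonnegative harmonic function [u] propagate along jumps, which can be
    steered towards that direction, so [u > 0] everywhere. *)

(** * Distribution functions *)

Definition cdfr {R : realType} (m : probability R R) (a : R) : R :=
  fine (m `]-oo, a]%classic).

Definition cdfl {R : realType} (m : probability R R) (a : R) : R :=
  fine (m `]-oo, a[%classic).

Lemma cdfrE {R : realType} (m : probability R R) (a : R) :
  m `]-oo, a]%classic = (cdfr m a)%:E.
Proof. by rewrite /cdfr fineK// fin_num_measure. Qed.

Lemma cdflE {R : realType} (m : probability R R) (a : R) :
  m `]-oo, a[%classic = (cdfl m a)%:E.
Proof. by rewrite /cdfl fineK// fin_num_measure. Qed.

Lemma cdfr_ge0 {R : realType} (m : probability R R) (a : R) : 0 <= cdfr m a.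
Proof. by rewrite -lee_fin -cdfrE. Qed.

Lemma cdfl_ge0 {R : realType} (m : probability R R) (a : R) : 0 <= cdfl m a.
Proof. by rewrite -lee_fin -cdflE. Qed.

Lemma cdfr_le1 {R : realType} (m : probability R R) (a : R) : cdfr m a <= 1.
Proof. by rewrite -lee_fin -cdfrE probability_le1. Qed.

Lemma cdfr_mono {R : realType} (m : probability R R) (a b : R) :
  a <= b -> cdfr m a <= cdfr m b.
Proof.
move=> ab; rewrite -lee_fin -!cdfrE; apply: le_measure; rewrite ?inE//.
by apply: subset_itvl; rewrite bnd_simp.
Qed.

Lemma cdfl_le_cdfr {R : realType} (m : probability R R) (a : R) :
  cdfl m a <= cdfr m a.
Proof.
rewrite -lee_fin -cdfrE -cdflE; apply: le_measure; rewrite ?inE//.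
by apply: subset_itvl; rewrite bnd_simp.
Qed.

Lemma cdfr_le_cdfl {R : realType} (m : probability R R) (a b : R) :
  a < b -> cdfr m a <= cdfl m b.
Proof.
move=> ab; rewrite -lee_fin -cdfrE -cdflE; apply: le_measure; rewrite ?inE//.
by apply: subset_itvl; rewrite bnd_simp.
Qed.

Lemma measure_set1E {R : realType} (m : probability R R) (z : R) :
  m [set z] = (cdfr m z - cdfl m z)%:E.
Proof.
have : m (`]-oo, z[%classic `|` [set z]) = (m `]-oo, z[%classic + m [set z])%E.
  rewrite measureU//; apply/seteqP; split => // x /= -[].
  by rewrite in_itv/= => /[swap] ->; rewrite ltxx.
rewrite (_ : _ `|` _ = `]-oo, z]%classic); last first.
  apply/seteqP; split => x /=; rewrite !in_itv/= le_eqVlt.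
    by case=> [->|->]; rewrite ?eqxx ?orbT.
  by move=> /orP[/eqP|]; [right|left].
rewrite cdfrE cdflE EFinB => ->.
by rewrite addeAC subee ?add0e.
Qed.

(** Continuity of the measure from above along the rays ending at [a + 1/(n+1)]. *)
Lemma cdfr_right {R : realType} (m : probability R R) (a e : R) : 0 < e ->
  exists2 d : R, 0 < d & cdfr m (a + d) <= cdfr m a + e.
Proof.
move=> e0.
have ninc : {homo (fun n : nat => `]-oo, a + n.+1%:R^-1]%classic)
    : n k / (n <= k)%N >-> (k <= n)%O}.
  move=> n k nk; apply/subsetPset; apply: subset_itvl.
  by rewrite bnd_simp lerD2l lef_pV2 ?posrE// ler_nat.
have := @nonincreasing_cvg_mu _ _ _ m
  (fun n => `]-oo, a + n.+1%:R^-1]%classic) _ _ _ ninc.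
rewrite -(itvNycEbigcap false) => cv.
have {cv}: ((cdfr m (a + n.+1%:R^-1))%:E @[n --> \oo] --> (cdfr m a)%:E).
  rewrite -cdfrE; under eq_fun do rewrite -cdfrE.
  apply: cv => //.
    by rewrite /= cdfrE ltry.
move/fine_cvgP => [_] /= /cvgrPdist_le/(_ _ e0)[N _ /(_ N (leqnn N))] /= H.
exists N.+1%:R^-1; first by rewrite invr_gt0.
by move: H; rewrite ler_norml => /andP[+ _]; rewrite lerBrDl => H; lra.
Qed.

Lemma cdfl_left {R : realType} (m : probability R R) (a e : R) : 0 < e ->
  exists2 d : R, 0 < d & cdfl m a <= cdfr m (a - d) + e.
Proof.
move=> e0.
have ndec : {homo (fun n : nat => `]-oo, a - n.+1%:R^-1]%classic)
    : n k / (n <= k)%N >-> (n <= k)%O}.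
  move=> n k nk; apply/subsetPset; apply: subset_itvl.
  by rewrite bnd_simp lerD2l lerN2 lef_pV2 ?posrE// ler_nat.
have := @nondecreasing_cvg_mu _ _ _ m
  (fun n => `]-oo, a - n.+1%:R^-1]%classic) _ _ ndec.
have -> : \bigcup_n `]-oo, a - n.+1%:R^-1]%classic = `]-oo, a[%classic.
  apply/seteqP; split => [x [n _] /=|x /=]; rewrite !in_itv/=.
    by move=> /le_lt_trans; apply; rewrite ltrBlDr ltrDl invr_gt0.
  move=> /ltr_add_invr[k xk]; exists k => //=; rewrite in_itv/=.
  by rewrite lerBrDr ltW.
move=> cv.
have {cv}: ((cdfr m (a - n.+1%:R^-1))%:E @[n --> \oo] --> (cdfl m a)%:E).
  rewrite -cdflE; under eq_fun do rewrite -cdfrE.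
  by apply: cv.
move/fine_cvgP => [_] /= /cvgrPdist_le/(_ _ e0)[N _ /(_ N (leqnn N))] /= H.
exists N.+1%:R^-1; first by rewrite invr_gt0.
by move: H; rewrite ler_norml => /andP[_ ]; lra.
Qed.

(** Take a coupling of cost below [e]. By Markov's inequality its two coordinates differ by [d] or
    more with probability at most [e / d], and off that event [u <= a] forces [v <= a + d].
    Closeness in [d_W] thus enters only through distribution functions, up to a shift. *)
Lemma dW_cdfr {R : realType} (m n : probability R R) (e d a : R) :
  (dW m n < e%:E)%E -> 0 < d ->
  cdfr m a <= cdfr n (a + d) + e / d /\ cdfr n a <= cdfr m (a + d) + e / d.
Proof.
move=> /ereal_inf_lt[_ [p pmn <-]] pe d0.
have mdiff : measurable_fun setT (fun x : R * R => (`|x.1 - x.2|)%:E).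
  apply/measurable_EFinP; apply: measurableT_comp => //.
  by apply: measurable_funB.
(* Markov's inequality for the distance of the two coordinates. *)
have := @le_integral_comp_abse _ _ _ p setT measurableT
  (fun z => (`|z.1 - z.2|)%:E) d id (@measurable_id _ _ _) _ _ mdiff d0.
set D := (X in (_ * p X)%E) => mk.
have mD : measurable D by apply: emeasurable_fun_c_infty => //; exact: measurableT_comp.
have pD : p D = (fine (p D))%:E by rewrite fineK// fin_num_measure.
have dD : fine (p D) <= e / d.
  rewrite ler_pdivlMr// mulrC -lee_fin EFinM -pD.
  apply: le_trans (ltW pe).
  apply: le_trans (mk _ _) _ => //.
  by under eq_integral do rewrite /= normr_id.
have m1 (A : set R) : measurable A -> measurable (fst @^-1` A : set (R * R)).
  by move=> mA; rewrite -[X in measurable X]setTI; apply: measurable_fst.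
have m2 (A : set R) : measurable A -> measurable (snd @^-1` A : set (R * R)).
  by move=> mA; rewrite -[X in measurable X]setTI; apply: measurable_snd.
have aux (b : R) : (fst @^-1` `]-oo, b]%classic `<=` snd @^-1` `]-oo, b + d]%classic `|` D)
  /\ (snd @^-1` `]-oo, b]%classic `<=` fst @^-1` `]-oo, b + d]%classic `|` D).
  split => -[u v] /=; rewrite !in_itv/= => ub.
    have [vb|vb] := leP v (b + d); first by left.
    right; split => //=; rewrite lee_fin normr_id.
    by rewrite ler0_norm; lra.
  have [vb|vb] := leP u (b + d); first by left.
  right; split => //=; rewrite lee_fin normr_id.
  by rewrite ger0_norm; lra.
have fin (A B : set (R * R)) : measurable A -> measurable B ->
    A `<=` B `|` D -> (p A <= p B + p D)%E.
  move=> mA mB AB; apply: le_trans (measureU2 _ mB mD).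
  by apply: le_measure; rewrite ?inE//; exact: measurableU.
split; rewrite -lee_fin EFinD.
  rewrite -!cdfrE -(proj1 (pmn _ _))// -(proj2 (pmn _ _))//.
  apply: le_trans (fin _ _ _ _ (aux a).1) _; [exact: m1|exact: m2|].
  by rewrite leeD2l// pD lee_fin.
rewrite -!cdfrE -(proj1 (pmn _ _))// -(proj2 (pmn _ _))//.
apply: le_trans (fin _ _ _ _ (aux a).2) _; [exact: m2|exact: m1|].
by rewrite leeD2l// pD lee_fin.
Qed.

(** Continuity is asked on the whole line, so a map given on an interval is first extended by
    freezing its argument at the endpoints. *)
Definition dW_continuous {R : realType} (H : R -> probability R R) :=
  forall t e : R, 0 < e -> exists2 d : R, 0 < d &
    forall s, `|s - t| < d -> (dW (H s) (H t) < e%:E)%E.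

(** Right continuity of the distribution function absorbs the shift in [dW_cdfr], so [t] is sent to
    an upper semicontinuous function; its opposite is lower semicontinuous, hence measurable. *)
Lemma measurable_cdfr {R : realType} (H : R -> probability R R) (a : R) :
  dW_continuous H -> measurable_fun setT (fun t => cdfr (H t) a).
Proof.
move=> cH.
suff mN : measurable_fun setT (fun t => (- cdfr (H t) a)%:E).
  move/measurable_EFinP : mN => mN.
  rewrite (_ : (fun _ => _) = -%R \o (fun t => - cdfr (H t) a)).
    exact: measurableT_comp.
  by apply/funext => t /=; rewrite opprK.
apply: lower_semicontinuous_measurable => t c; rewrite lte_fin => ct.
(* One third of the slack pays for right continuity, one third for [e / d] in [dW_cdfr], and the
   last keeps the inequality strict. *)
pose g := (- cdfr (H t) a - c) / 3.
have g0 : 0 < g by rewrite divr_gt0// subr_gt0.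
have [d d0 dH] := cdfr_right (H t) a _ g0.
have [r r0 rH] := cH t (g * d) (mulr_gt0 g0 d0).
exists (ball t r); first exact: nbhsx_ballx.
move=> s ts; rewrite lte_fin.
have /(rH s) sH : `|s - t| < r by rewrite distrC; exact: ts.
have [+ _] := dW_cdfr _ _ _ _ a sH d0.
rewrite mulfK ?gt_eqF// => h.
have : g * 3 = - cdfr (H t) a - c by rewrite /g divfK.
lra.
Qed.

Lemma measurable_cdfl {R : realType} (H : R -> probability R R) (a : R) :
  dW_continuous H -> measurable_fun setT (fun t => cdfl (H t) a).
Proof.
move=> cH.
apply: (@measurable_fun_cvg _ _ _ _ (fun n t => cdfr (H t) (a - n.+1%:R^-1))).
  by move=> n; exact: measurable_cdfr.
move=> t _; apply/cvgrPdist_le => e e0.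
have [d d0 dH] := cdfl_left (H t) a _ e0.
have [N] := ltr_add_invr d0; rewrite add0r => Nd.
exists N => // n /= Nn.
have nN : n.+1%:R^-1 <= N.+1%:R^-1 :> R by rewrite lef_pV2 ?posrE// ler_nat.
have n0 : 0 < n.+1%:R^-1 :> R by rewrite invr_gt0.
have h1 : cdfr (H t) (a - n.+1%:R^-1) <= cdfl (H t) a by apply: cdfr_le_cdfl; rewrite ltrBlDr ltrDl.
have h2 : cdfr (H t) (a - d) <= cdfr (H t) (a - n.+1%:R^-1).
  by apply: cdfr_mono; rewrite lerD2l lerN2 (le_trans nN (ltW Nd)).
by rewrite ger0_norm; lra.
Qed.

(** * Harmonic functions and the maximum principle *)

Definition jump_law {R : realType} (beta mean : R) (mu : probability R R) :=
  mu `[0, beta]%classic = 1%E /\ \int[mu]_(k in `[0, beta]) k = mean.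

(** Restricted to [[0, beta]] because nothing is known about [G] at the points reached by negative
    jumps. *)
Definition bounded_measurable {R : realType} (beta : R) (f : R -> R) :=
  measurable_fun (`[0, beta]%classic : set R) f /\
  exists C : R, forall k, 0 <= k <= beta -> `|f k| <= C.

Lemma bounded_measurable_integrable {R : realType} (beta : R)
    (mu : probability R R) (f : R -> R) :
  bounded_measurable beta f -> mu.-integrable `[0, beta] (EFin \o f).
Proof.
move=> [mf [C fC]]; apply: measurable_bounded_integrable => //.
  by apply: le_lt_trans (probability_le1 _ _) (ltry _).
exists C; split; first exact: num_real.
move=> x Cx k /= kb; apply: le_trans (ltW Cx).
by apply: fC; move: kb; rewrite in_itv.
Qed.

Lemma bounded_measurable_affine {R : realType} (beta c A : R) :
  bounded_measurable beta (fun k => c + A * k).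
Proof.
split.
  by apply: measurable_funD => //; apply: measurable_funM.
exists (`|c| + `|A| * beta) => k /andP[k0 kb].
apply: le_trans (ler_normD _ _) _; rewrite lerD2l normrM.
by rewrite (ger0_norm k0) ler_wpM2l.
Qed.

Lemma bounded_measurable_id {R : realType} (beta : R) :
  bounded_measurable beta (fun k => k).
Proof.
have := bounded_measurable_affine beta 0 1.
by under eq_fun do rewrite add0r mul1r.
Qed.

Lemma bounded_measurableB {R : realType} (beta : R) (f g : R -> R) :
  bounded_measurable beta f -> bounded_measurable beta g ->
  bounded_measurable beta (fun k => f k - g k).
Proof.
move=> [mf [C fC]] [mg [C' gC]]; split; first exact: measurable_funB.
exists (C + C') => k kb; apply: le_trans (ler_normB _ _) _.
by rewrite lerD ?fC ?gC.
Qed.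

Lemma bounded_measurable_cst {R : realType} (beta c : R) :
  bounded_measurable beta (fun=> c).
Proof. by split; [exact: measurable_cst|exists `|c|]. Qed.

Lemma Rintegral_affine {R : realType} (beta mean c A : R) (mu : probability R R) :
  jump_law beta mean mu ->
  \int[mu]_(k in `[0, beta]) (c + A * k) = c + A * mean.
Proof.
move=> [mu1 <-]; rewrite RintegralD//.
- rewrite Rintegral_cst// (_ : fine _ = 1); last exact: (congr1 fine mu1).
  rewrite mulr1; congr (_ + _).
  rewrite RintegralZl//.
  exact/bounded_measurable_integrable/bounded_measurable_id.
- exact/bounded_measurable_integrable/bounded_measurable_cst.
- apply: bounded_measurable_integrable.
  have := bounded_measurable_affine beta 0 A.
  by under eq_fun do rewrite add0r.
Qed.

(** Jump integrals are estimated only through affine bounds, whose integral depends on the law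
    through its mean alone. This is how the equality of the means of [mu] and [nu] enters. *)
Lemma Rintegral_ge_affine {R : realType} (beta mean c A : R)
    (mu : probability R R) (f : R -> R) :
  jump_law beta mean mu -> bounded_measurable beta f ->
  (forall k, 0 <= k <= beta -> c + A * k <= f k) ->
  c + A * mean <= \int[mu]_(k in `[0, beta]) f k.
Proof.
move=> jm bf cf; rewrite -(Rintegral_affine _ _ c A _ jm).
apply: le_Rintegral => //.
- exact/bounded_measurable_integrable/bounded_measurable_affine.
- exact: bounded_measurable_integrable.
Qed.

Lemma Rintegral_le_affine {R : realType} (beta mean c A : R)
    (mu : probability R R) (f : R -> R) :
  jump_law beta mean mu -> bounded_measurable beta f ->
  (forall k, 0 <= k <= beta -> f k <= c + A * k) ->
  \int[mu]_(k in `[0, beta]) f k <= c + A * mean.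
Proof.
move=> jm bf cf; rewrite -(Rintegral_affine _ _ c A _ jm).
apply: le_Rintegral => //; first exact: bounded_measurable_integrable.
exact/bounded_measurable_integrable/bounded_measurable_affine.
Qed.

Lemma Rintegral_boundedB {R : realType} (beta : R) (mu : probability R R)
    (f g : R -> R) :
  bounded_measurable beta f -> bounded_measurable beta g ->
  \int[mu]_(k in `[0, beta]) (f k - g k) =
  \int[mu]_(k in `[0, beta]) f k - \int[mu]_(k in `[0, beta]) g k.
Proof.
by move=> bf bg; rewrite RintegralB//; exact: bounded_measurable_integrable.
Qed.

Definition harmonic2 {R : realType} (beta : R) (mu nu : probability R R)
    (h : R -> R -> R) := forall x y, 0 < x -> 0 < y ->
  [/\ bounded_measurable beta (fun k => h (x + k) y),
      bounded_measurable beta (fun k => h x (y + k)) &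
      x * \int[mu]_(k in `[0, beta]) (h (x + k) y - h x y) +
      y * \int[nu]_(k in `[0, beta]) (h x (y + k) - h x y) = 0].

(** Harmonicity for an urn with three colours, drawn in proportion to their weights, each with its
    own jump law. *)
Definition harmonic3 {R : realType} (beta : R) (m1 m2 m3 : probability R R)
    (g : R -> R -> R -> R) := forall x e y, 0 < x -> 0 < e -> 0 < y ->
  [/\ bounded_measurable beta (fun k => g (x + k) e y),
      bounded_measurable beta (fun k => g x (e + k) y),
      bounded_measurable beta (fun k => g x e (y + k)) &
      x * \int[m1]_(k in `[0, beta]) (g (x + k) e y - g x e y) +
      e * \int[m2]_(k in `[0, beta]) (g x (e + k) y - g x e y) +
      y * \int[m3]_(k in `[0, beta]) (g x e (y + k) - g x e y) = 0].

Lemma Rintegral0 {R : realType} (beta : R) (mu : probability R R) (c : R) :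
  \int[mu]_(k in `[0, beta]) (c - c) = 0.
Proof. by rewrite subrr Rintegral_cst// mul0r. Qed.

Lemma Rintegral_incrementB {R : realType} (beta c c' : R) (mu : probability R R)
    (f g : R -> R) :
  bounded_measurable beta f -> bounded_measurable beta g ->
  \int[mu]_(k in `[0, beta]) (f k - g k - (c - c')) =
  \int[mu]_(k in `[0, beta]) (f k - c) - \int[mu]_(k in `[0, beta]) (g k - c').
Proof.
move=> bf bg; rewrite -Rintegral_boundedB.
- by apply: eq_Rintegral => k _; ring.
- exact: bounded_measurableB bf (bounded_measurable_cst _ _).
- exact: bounded_measurableB bg (bounded_measurable_cst _ _).
Qed.

Lemma harmonic2B {R : realType} (beta : R) (mu nu : probability R R)
    (h1 h2 : R -> R -> R) :
  harmonic2 beta mu nu h1 -> harmonic2 beta mu nu h2 ->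
  harmonic2 beta mu nu (fun x y => h1 x y - h2 x y).
Proof.
move=> H1 H2 x y x0 y0; have [a1 b1 e1] := H1 _ _ x0 y0.
have [a2 b2 e2] := H2 _ _ x0 y0.
split; [exact: bounded_measurableB|exact: bounded_measurableB|].
by rewrite !Rintegral_incrementB//; lra.
Qed.

Lemma harmonic3B {R : realType} (beta : R) (m1 m2 m3 : probability R R)
    (g1 g2 : R -> R -> R -> R) :
  harmonic3 beta m1 m2 m3 g1 -> harmonic3 beta m1 m2 m3 g2 ->
  harmonic3 beta m1 m2 m3 (fun x e y => g1 x e y - g2 x e y).
Proof.
move=> H1 H2 x e y x0 e0 y0; have [a1 b1 c1 e1] := H1 _ _ _ x0 e0 y0.
have [a2 b2 c2 e2] := H2 _ _ _ x0 e0 y0.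
split; [exact: bounded_measurableB|exact: bounded_measurableB|
  exact: bounded_measurableB|].
by rewrite !Rintegral_incrementB//; lra.
Qed.

(** * Splitting one colour of the urn into two *)

Section split_colours.
Context {R : realType} (beta : R) (mu nu : probability R R) (h : R -> R -> R).
Hypothesis hh : harmonic2 beta mu nu h.

(** A function blind to the extra colour has no increment in it. Giving that colour the law [mu]
    matches [harmonic3_merge_left], so that the two functions can be compared. *)
Lemma harmonic3_skip_left : harmonic3 beta mu mu nu (fun x _ y => h x y).
Proof.
move=> x e y x0 e0 y0; have [a1 b1 e1] := hh _ _ x0 y0.
split=> //; first exact: bounded_measurable_cst.
by rewrite Rintegral0 mulr0 addr0.
Qed.

Lemma harmonic3_skip_right : harmonic3 beta mu nu nu (fun x _ y => h x y).
Proof.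
move=> x e y x0 e0 y0; have [a1 b1 e1] := hh _ _ x0 y0.
split=> //; first exact: bounded_measurable_cst.
by rewrite Rintegral0 mulr0 addr0.
Qed.

(** Two colours with the same jump law act as one: their integrals coincide and the weights add up
    to [x + e]. *)
Lemma harmonic3_merge_left : harmonic3 beta mu mu nu (fun x e y => h (x + e) y).
Proof.
move=> x e y x0 e0 y0; have [a1 b1 e1] := hh _ _ (addr_gt0 x0 e0) y0.
have E : (fun k => h (x + k + e) y) = (fun k => h (x + e + k) y).
  by apply/funext => k; rewrite addrAC.
have E' : (fun k => h (x + (e + k)) y) = (fun k => h (x + e + k) y).
  by apply/funext => k; rewrite addrA.
split; rewrite ?E ?E' //.
under eq_Rintegral do rewrite addrAC.
under [X in _ + e * X + _]eq_Rintegral do rewrite addrA.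
by rewrite -mulrDl.
Qed.

Lemma harmonic3_merge_right : harmonic3 beta mu nu nu (fun x e y => h x (e + y)).
Proof.
move=> x e y x0 e0 y0; have [a1 b1 e1] := hh _ _ x0 (addr_gt0 e0 y0).
have E : (fun k => h x (e + k + y)) = (fun k => h x (e + y + k)).
  by apply/funext => k; rewrite addrAC.
have E' : (fun k => h x (e + (y + k))) = (fun k => h x (e + y + k)).
  by apply/funext => k; rewrite addrA.
split; rewrite ?E ?E' //.
under [X in _ + e * X + _]eq_Rintegral do rewrite addrAC.
under [X in _ + y * X]eq_Rintegral do rewrite addrA.
by rewrite -addrA -mulrDl.
Qed.

End split_colours.

(** A certificate of superharmonicity: increments have affine upper bounds whose slopes have
    nonpositive weighted sum. For jump laws of equal mean it bounds the drift without any
    measurability of [b]. *)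
Definition superlinear3 {R : realType} (beta : R) (b : R -> R -> R -> R)
    (x e y : R) := exists A1 A2 A3,
  [/\ forall k, 0 <= k <= beta -> b (x + k) e y <= b x e y + A1 * k,
      forall k, 0 <= k <= beta -> b x (e + k) y <= b x e y + A2 * k,
      forall k, 0 <= k <= beta -> b x e (y + k) <= b x e y + A3 * k &
      x * A1 + e * A2 + y * A3 <= 0].

Lemma superlinear3_affine {R : realType} (beta c t : R) (b : R -> R -> R -> R) x e y :
  0 <= t -> superlinear3 beta b x e y ->
  superlinear3 beta (fun x e y => c + t * b x e y) x e y.
Proof.
move=> t0 [A1 [A2 [A3 [h1 h2 h3 h4]]]].
exists (t * A1), (t * A2), (t * A3); split => [k kb|k kb|k kb|].
- by rewrite -addrA lerD2l -mulrA -mulrDr ler_wpM2l// h1.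
- by rewrite -addrA lerD2l -mulrA -mulrDr ler_wpM2l// h2.
- by rewrite -addrA lerD2l -mulrA -mulrDr ler_wpM2l// h3.
- rewrite (_ : _ + _ = t * (x * A1 + e * A2 + y * A3)); last by ring.
  by rewrite mulr_ge0_le0.
Qed.

(** The drop is linear in [k] at a positive rate that is uniform over jumps, which gives
    [1 / (1 + s)] a strictly negative drift. *)
Lemma inv1D_drop {R : realType} (beta s k : R) : 0 < s -> 0 <= k <= beta ->
  (1 + (s + k))^-1 <= (1 + s)^-1 - ((1 + s) * (1 + s + beta))^-1 * k.
Proof.
move=> s0 /andP[k0 kb].
have -> : (1 + (s + k))^-1 = (1 + s)^-1 - ((1 + s) * (1 + s + k))^-1 * k.
  by field; rewrite ?gt_eqF//; lra.
rewrite lerD2l lerN2 ler_wpM2r// lef_pV2 ?posrE ?mulr_gt0//; try lra.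
by rewrite ler_wpM2l//; lra.
Qed.

(* Perturbing by [eta / (1 + s)] makes the supersolution strict on bounded
   regions, which excludes a negative infimum. *)
Lemma maximum_principle {R : realType} (beta mean : R) (m1 m2 m3 : probability R R)
    (D : R -> R -> R -> Prop) (g b : R -> R -> R -> R) :
  0 < mean -> 0 <= beta ->
  jump_law beta mean m1 -> jump_law beta mean m2 -> jump_law beta mean m3 ->
  (forall x e y, D x e y -> [/\ 0 < x, 0 < e & 0 < y]) ->
  (forall x e y k, D x e y -> 0 <= k <= beta ->
     [/\ D (x + k) e y, D x (e + k) y & D x e (y + k)]) ->
  harmonic3 beta m1 m2 m3 g ->
  (forall x e y, D x e y -> superlinear3 beta b x e y) ->
  (exists L, forall x e y, D x e y -> L <= g x e y + b x e y) ->
  (forall eps, 0 < eps -> exists M, forall x e y, D x e y -> M < x + e + y ->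
     - eps <= g x e y + b x e y) ->
  forall x e y, D x e y -> 0 <= g x e y + b x e y.
Proof.
move=> mean0 beta0 j1 j2 j3 Dpos Djump hg hb [L HL] Hinf x0 e0 y0 D0.
rewrite leNgt; apply/negP => w0.
(* Half the depth of the supposed negative value: the perturbation is at most [eta], so the
   perturbed value stays negative. *)
pose eta := - (g x0 e0 y0 + b x0 e0 y0) / 2.
have eta0 : 0 < eta by rewrite /eta; lra.
pose w x e y := g x e y + b x e y + eta * (1 + (x + e + y))^-1.
pose S := [set r : R | exists x e y, D x e y /\ r = w x e y].
have v01 x e y : D x e y -> 0 <= eta * (1 + (x + e + y))^-1 <= eta.
  move=> /Dpos[xp ep yp]; apply/andP; split.
    by rewrite mulr_ge0 ?invr_ge0//; lra.
  by rewrite ler_piMr ?(ltW eta0)// invf_le1//; lra.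
have Sinf : has_inf S.
  split; first by exists (w x0 e0 y0), x0, e0, y0.
  exists L => _ [x [e [y [Dp ->]]]].
  by have := HL _ _ _ Dp; have := v01 _ _ _ Dp; rewrite /w; lra.
pose I := inf S.
have wI x e y : D x e y -> I <= w x e y.
  by move=> Dp; apply: ge_inf; [exact: Sinf.2|exists x, e, y].
have I0 : I < 0.
  apply: le_lt_trans (wI _ _ _ D0) _.
  by have := v01 _ _ _ D0; rewrite /w /eta; lra.
have [M0 HM0] := Hinf (- I / 2) ltac:(lra).
pose M := Num.max M0 0.
(* A lower bound for the downward drift of the perturbation over all points with total weight at
   most [M]. *)
pose c0 := eta * mean / ((1 + M) * (1 + M + beta)).
have M_ge0 : 0 <= M by rewrite le_max lexx orbT.
have den0 : 0 < (1 + M) * (1 + M + beta) by rewrite mulr_gt0//; lra.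
have c00 : 0 < c0 by rewrite divr_gt0// mulr_gt0.
(* Being within [- I / 2] of the infimum excludes totals above [M]. Being within [c0 / 2] means that
   no jump lowers [w] by more than half of the drift [c0]. *)
have t0 : 0 < Num.min (c0 / 2) (- I / 2) by rewrite lt_min; apply/andP; split; lra.
have [_ [x [e [y [Dp ->]]]]] := inf_adherent t0 Sinf.
rewrite -/I -ltrBlDl lt_min => /andP[wc wi].
have [xp ep yp] := Dpos _ _ _ Dp.
set s := x + e + y.
have s0 : 0 < s by rewrite /s; lra.
have sM : s <= M.
  rewrite leNgt; apply/negP; rewrite gt_max => /andP[sM _].
  by have := HM0 _ _ _ Dp sM; have := v01 _ _ _ Dp; move: wi; rewrite /w; lra.
have [A1 [A2 [A3 [b1 b2 b3 bA]]]] := hb _ _ _ Dp.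
have [g1 g2 g3 gE] := hg _ _ _ xp ep yp.
pose q := eta * ((1 + s) * (1 + s + beta))^-1.
have cst := bounded_measurable_cst beta (g x e y).
have main x' e' y' k A : D x' e' y' -> x' + e' + y' = s + k -> 0 <= k <= beta ->
    b x' e' y' <= b x e y + A * k ->
    - (c0 / 2) + (q - A) * k <= g x' e' y' - g x e y.
  move=> Dp' sE kb bk.
  have := wI _ _ _ Dp'; move: wc; rewrite /w sE -/s => wc wk.
  have := inv1D_drop _ _ _ s0 kb; rewrite -(ler_pM2l eta0) => hv.
  have qE : eta * ((1 + s)^-1 - ((1 + s) * (1 + s + beta))^-1 * k) =
     eta * (1 + s)^-1 - q * k by rewrite /q; ring.
  by rewrite qE in hv; lra.
have i1 : - (c0 / 2) + (q - A1) * mean <= \int[m1]_(k in `[0, beta]) (g (x + k) e y - g x e y).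
  apply: Rintegral_ge_affine => //; first exact: bounded_measurableB.
  move=> k kb; have [Dk _ _] := Djump _ _ _ _ Dp kb.
  by apply: main => //; [rewrite /s; ring|exact: b1].
have i2 : - (c0 / 2) + (q - A2) * mean <= \int[m2]_(k in `[0, beta]) (g x (e + k) y - g x e y).
  apply: Rintegral_ge_affine => //; first exact: bounded_measurableB.
  move=> k kb; have [_ Dk _] := Djump _ _ _ _ Dp kb.
  by apply: main => //; [rewrite /s; ring|exact: b2].
have i3 : - (c0 / 2) + (q - A3) * mean <= \int[m3]_(k in `[0, beta]) (g x e (y + k) - g x e y).
  apply: Rintegral_ge_affine => //; first exact: bounded_measurableB.
  move=> k kb; have [_ _ Dk] := Djump _ _ _ _ Dp kb.
  by apply: main => //; [rewrite /s; ring|exact: b3].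
rewrite -(ler_pM2l xp) in i1; rewrite -(ler_pM2l ep) in i2; rewrite -(ler_pM2l yp) in i3.
have qc : c0 <= q * mean.
  rewrite /c0 /q mulrAC ler_wpM2r ?(ltW mean0)// ler_wpM2l ?(ltW eta0)//.
  rewrite lef_pV2 ?posrE//; last by rewrite mulr_gt0//; lra.
  by rewrite ler_pM//; lra.
(* Weighting the three estimates by [x], [e], [y] cancels the integrals of [g] by harmonicity; what
   remains contradicts the sign of the weighted sum of slopes. *)
have : s * (- (c0 / 2) + q * mean) <= (x * A1 + e * A2 + y * A3) * mean.
  move: (lerD (lerD i1 i2) i3); rewrite gE => h.
  by rewrite /s; lra.
have : (x * A1 + e * A2 + y * A3) * mean <= 0 by rewrite mulr_le0_ge0// ltW.
have : 0 < s * (- (c0 / 2) + q * mean) by rewrite mulr_gt0//; lra.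
lra.
Qed.

(** * Barriers *)

(** Minus the logarithm of the colour fraction [z / s], corrected by [beta / z] to compensate for
    jumps of size up to [beta]. *)
Definition log_barrier {R : realType} (beta s z : R) : R :=
  ln s - ln z + beta / z.

Definition log_barrier3 {R : realType} (beta x e y : R) : R :=
  log_barrier beta (x + e + y) x + log_barrier beta (x + e + y) e +
  log_barrier beta (x + e + y) y.

Lemma ln_ratio_le {R : realType} (a b : R) : 0 < a -> 0 < b -> ln b - ln a <= (b - a) / a.
Proof.
move=> a0 b0; rewrite -ln_div ?posrE//.
have -> : b / a = 1 + (b - a) / a by field; rewrite gt_eqF.
apply: le_ln1Dx; rewrite -subr_gt0 (_ : _ - _ = b / a) ?divr_gt0//.
by field; rewrite gt_eqF.
Qed.

Lemma log_barrier_jump_other {R : realType} (beta s z k : R) :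
  0 < s -> 0 <= k -> log_barrier beta (s + k) z <= log_barrier beta s z + s^-1 * k.
Proof.
move=> s0 k0; have := ln_ratio_le s (s + k) s0 ltac:(lra).
by rewrite (_ : s + k - s = k) ?/log_barrier; lra.
Qed.

(** Concavity of the logarithm gives a decrease of [k / (z + k)], short of [k / z] by
    [k^2 / (z (z + k))]. The correction decreases by [beta k / (z (z + k))], which covers this since
    [k <= beta]. *)
Lemma log_barrier_jump_own {R : realType} (beta s z k : R) :
  0 < z -> 0 < s -> 0 <= k <= beta ->
  log_barrier beta (s + k) (z + k) <= log_barrier beta s z + (s^-1 - z^-1) * k.
Proof.
move=> z0 s0 /andP[k0 kb].
have := log_barrier_jump_other beta s z k s0 k0.
have := ln_ratio_le (z + k) z ltac:(lra) z0.
have -> : (z - (z + k)) / (z + k) = - (k / (z + k)) by field; rewrite gt_eqF; lra.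
rewrite /log_barrier => h1 h2.
have h3 : beta / (z + k) - beta / z - k / (z + k) <= - z^-1 * k.
  rewrite -subr_ge0 (_ : _ - _ = k * (beta - k) / (z * (z + k))); last first.
    by field; rewrite !gt_eqF//; lra.
  by rewrite mulr_ge0 ?invr_ge0 ?mulr_ge0//; lra.
lra.
Qed.

Lemma log_barrier_ge0 {R : realType} (beta s z : R) :
  0 <= beta -> 0 < z -> z <= s -> 0 <= log_barrier beta s z.
Proof.
move=> b0 z0 zs; rewrite addr_ge0//; last by rewrite divr_ge0// ltW.
by rewrite subr_ge0 ler_ln ?posrE//; lra.
Qed.

Lemma log_barrier_le {R : realType} (beta s z H : R) :
  0 <= beta -> 0 < z -> 0 < s -> log_barrier beta s z <= H -> expR (- H) * s <= z.
Proof.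
move=> b0 z0 s0 BH; rewrite -ler_ln ?posrE ?mulr_gt0 ?expR_gt0//.
rewrite lnM ?posrE ?expR_gt0// expRK.
have : 0 <= beta / z by rewrite divr_ge0// ltW.
by move: BH; rewrite /log_barrier; lra.
Qed.

Lemma log_barrier3_superlinear {R : realType} (beta x e y : R) :
  0 < x -> 0 < e -> 0 < y -> superlinear3 beta (log_barrier3 beta) x e y.
Proof.
move=> x0 e0 y0; pose s := x + e + y; have s0 : 0 < s by rewrite /s; lra.
(* Each of the three logarithms of the total contributes [1 / s], and the own colour subtracts its
   inverse; weighted, the slopes sum to [3 - 3 = 0]. *)
exists (3 * s^-1 - x^-1), (3 * s^-1 - e^-1), (3 * s^-1 - y^-1).
have E1 k : x + k + e + y = s + k by rewrite /s; ring.
have E2 k : x + (e + k) + y = s + k by rewrite /s; ring.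
have E3 k : x + e + (y + k) = s + k by rewrite /s; ring.
split => [k kb|k kb|k kb|].
- rewrite /log_barrier3 E1 -/s; have /andP[k0 _] := kb.
  have := log_barrier_jump_own _ _ _ _ x0 s0 kb.
  have := log_barrier_jump_other beta _ e _ s0 k0.
  by have := log_barrier_jump_other beta _ y _ s0 k0; lra.
- rewrite /log_barrier3 E2 -/s; have /andP[k0 _] := kb.
  have := log_barrier_jump_own _ _ _ _ e0 s0 kb.
  have := log_barrier_jump_other beta _ x _ s0 k0.
  by have := log_barrier_jump_other beta _ y _ s0 k0; lra.
- rewrite /log_barrier3 E3 -/s; have /andP[k0 _] := kb.
  have := log_barrier_jump_own _ _ _ _ y0 s0 kb.
  have := log_barrier_jump_other beta _ x _ s0 k0.
  by have := log_barrier_jump_other beta _ e _ s0 k0; lra.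
- rewrite [leLHS](_ : _ = 0)//; rewrite /s; field.
  by rewrite !gt_eqF//; lra.
Qed.

(** The squared distance of the first colour's fraction to [t], with a term decreasing in the total
    weight that absorbs second-order errors. *)
Definition square_barrier {R : realType} (beta t x y : R) : R :=
  (x / (x + y) - t) ^+ 2 + 6 * beta / (x + y).

(** Here [a] is the deviation of the fraction from its target, and a jump moves the fraction by
    [u * (k / (s + k))]. Linearising costs at most [2 k p] and the square at most [k p], where [p]
    is set below; the correction drops by [6 * beta * p]. *)
Lemma square_jump {R : realType} (a u s k beta : R) :
  0 < s -> 0 <= k <= beta -> `|a| <= 1 -> `|u| <= 1 ->
  (a + u * (k / (s + k))) ^+ 2 + 6 * beta / (s + k) <=
  a ^+ 2 + 6 * beta / s + 2 * a * u / s * k.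
Proof.
move=> s0 /andP[k0 kb] a1 u1.
(* This is [1/s - 1/(s + k)], so [k / (s + k) = s * p] and [k / s = s * p + k * p]. *)
pose p := k / (s * (s + k)).
have p0 : 0 <= p by rewrite divr_ge0 ?mulr_ge0//; lra.
have -> : k / (s + k) = s * p by rewrite /p; field; rewrite !gt_eqF//; lra.
have -> : 6 * beta / (s + k) = 6 * beta / s - 6 * beta * p.
  by rewrite /p; field; rewrite !gt_eqF//; lra.
have -> : 2 * a * u / s * k = 2 * (a * u) * (s * p + k * p).
  by rewrite /p; field; rewrite !gt_eqF//; lra.
have au : - 1 <= a * u.
  suff : `|a * u| <= 1 by rewrite ler_norml => /andP[].
  by rewrite normrM mulr_ile1.
have u2 : u ^+ 2 <= 1 by rewrite -real_normK ?num_real// expr_le1.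
have sp : (s * p) ^+ 2 <= k * p.
  rewrite -subr_ge0 (_ : _ - _ = k * p * (k / (s + k))).
    by apply: mulr_ge0; [exact: mulr_ge0|apply: divr_ge0 => //; lra].
  by rewrite /p; field; rewrite !gt_eqF//; lra.
have usp : (u * (s * p)) ^+ 2 <= k * p.
  rewrite exprMn; apply: le_trans sp.
  by rewrite ler_piMl// sqr_ge0.
have kp0 : 0 <= k * p by rewrite mulr_ge0.
have bkp : k * p <= beta * p by rewrite ler_wpM2r.
have aukp : - 1 * (k * p) <= a * u * (k * p) by rewrite ler_wpM2r.
rewrite sqrrD.
have -> : a * (u * (s * p)) *+ 2 = 2 * (a * u) * (s * p) by rewrite -mulr_natl; ring.
lra.
Qed.

Lemma fraction_in01 {R : realType} (x y : R) : 0 < x -> 0 < y -> 0 <= x / (x + y) <= 1.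
Proof.
move=> x0 y0; apply/andP; split; first by rewrite divr_ge0//; lra.
by rewrite ler_pdivrMr; lra.
Qed.

(** To first order the fraction [th] is a martingale: the slopes are proportional to [1 - th] and
    [- th], and the weights to [th] and [1 - th]. *)
Lemma square_barrier_superlinear {R : realType} (beta t x e y : R) :
  0 <= t <= 1 -> 0 < x -> 0 < e -> 0 < y ->
  superlinear3 beta (fun x e y => square_barrier beta t (x + e) y) x e y.
Proof.
move=> /andP[t0 t1] x0 e0 y0; pose X := x + e; have X0 : 0 < X by rewrite /X; lra.
pose s := X + y; have s0 : 0 < s by rewrite /s; lra.
pose th := X / s.
have /andP[th0 th1] : 0 <= th <= 1 by exact: fraction_in01.
pose a := th - t.
have a1 : `|a| <= 1 by rewrite ler_norml /a; lra.
have left k : 0 <= k <= beta -> square_barrier beta t (X + k) y <=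
    square_barrier beta t X y + 2 * a * (1 - th) / s * k.
  move=> kb; have u1 : `|1 - th| <= 1 by rewrite ler_norml; lra.
  apply: le_trans (square_jump a (1 - th) s k beta s0 kb a1 u1).
  have /andP[k0 _] := kb.
  rewrite /square_barrier.
  have -> : X + k + y = s + k by rewrite /s; ring.
  rewrite lerD2r le_eqVlt; apply/orP; left; apply/eqP; congr (_ ^+ 2).
  by rewrite /a /th; field; rewrite !gt_eqF//; lra.
exists (2 * a * (1 - th) / s), (2 * a * (1 - th) / s), (2 * a * (- th) / s).
split => [k kb|k kb|k kb|].
- by rewrite -/X (_ : x + k + e = X + k); [exact: left|rewrite /X; ring].
- by rewrite -/X (_ : x + (e + k) = X + k); [exact: left|rewrite /X; ring].
- have u1 : `|- th| <= 1 by rewrite ler_norml; lra.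
  apply: le_trans (square_jump a (- th) s k beta s0 kb a1 u1).
  have /andP[k0 _] := kb.
  rewrite /square_barrier -/X.
  have -> : X + (y + k) = s + k by rewrite /s; ring.
  rewrite lerD2r le_eqVlt; apply/orP; left; apply/eqP; congr (_ ^+ 2).
  by rewrite /a /th; field; rewrite !gt_eqF//; lra.
- rewrite -mulrDl -/X (_ : X = th * s); last by rewrite divfK// gt_eqF.
  rewrite (_ : y = (1 - th) * s); last first.
    by rewrite /th mulrBl divfK ?gt_eqF// /s; ring.
  by rewrite [leLHS](_ : _ = 0)//; field; rewrite gt_eqF.
Qed.

(* The logarithmic barriers make the colour fractions bounded away from zero at
   infinity, up to an arbitrarily small cost. *)
Lemma cdfr_le_cdfl_of_infinity {R : realType} (beta mean z : R)
    (m1 m2 m3 : probability R R) (lo hi : R -> R -> R -> probability R R) :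
  0 < mean -> 0 <= beta ->
  jump_law beta mean m1 -> jump_law beta mean m2 -> jump_law beta mean m3 ->
  (forall d, harmonic3 beta m1 m2 m3
     (fun x e y => cdfr (lo x e y) (z - d) - cdfr (hi x e y) z)) ->
  (forall rho eta, 0 < rho -> 0 < eta -> exists2 d, 0 < d &
     exists M, forall x e y, 0 < x -> 0 < e -> 0 < y ->
       rho * (x + e + y) <= x -> rho * (x + e + y) <= e ->
       rho * (x + e + y) <= y -> M < x + e + y ->
       cdfr (hi x e y) z <= cdfr (lo x e y) (z - d) + eta) ->
  forall x e y, 0 < x -> 0 < e -> 0 < y ->
    cdfr (hi x e y) z <= cdfl (lo x e y) z.
Proof.
move=> mean0 beta0 j1 j2 j3 harm inf x e y x0 e0 y0.
have B0 x' e' y' : 0 < x' -> 0 < e' -> 0 < y' ->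
    [/\ 0 <= log_barrier beta (x' + e' + y') x',
     0 <= log_barrier beta (x' + e' + y') e' &
     0 <= log_barrier beta (x' + e' + y') y'].
  by move=> xp ep yp; split; apply: log_barrier_ge0 => //; lra.
apply/ler_addgt0Pr => eta eta0.
(* Small enough that the barrier costs at most [eta / 2] at the given point. *)
pose t := eta / 2 / (1 + log_barrier3 beta x e y).
have B1 : 0 < 1 + log_barrier3 beta x e y.
  by rewrite /log_barrier3; have [] := B0 _ _ _ x0 e0 y0; lra.
have t0 : 0 < t by rewrite /t !divr_gt0.
have tB : t * log_barrier3 beta x e y <= eta / 2.
  have : t * (1 + log_barrier3 beta x e y) = eta / 2 by rewrite /t divfK ?gt_eqF.
  by rewrite mulrDr mulr1; lra.
have rho0 : 0 < expR (- t^-1) by exact: expR_gt0.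
have [d d0 [M HM]] := inf _ _ rho0 (divr_gt0 eta0 (ltr0n _ 2)).
have := maximum_principle beta mean m1 m2 m3
  (fun x e y => [/\ 0 < x, 0 < e & 0 < y])
  (fun x e y => cdfr (lo x e y) (z - d) - cdfr (hi x e y) z)
  (fun x e y => eta / 2 + t * log_barrier3 beta x e y) mean0 beta0 j1 j2 j3.
have tB0 x' e' y' : 0 < x' -> 0 < e' -> 0 < y' -> 0 <= t * log_barrier3 beta x' e' y'.
  move=> xp ep yp; rewrite mulr_ge0 ?(ltW t0)// /log_barrier3.
  by have [] := B0 _ _ _ xp ep yp; lra.
have bd x' e' y' : 0 <= cdfr (lo x' e' y') (z - d) /\ cdfr (hi x' e' y') z <= 1.
  by split; [exact: cdfr_ge0|exact: cdfr_le1].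
move=> mp; have {mp} : 0 <= cdfr (lo x e y) (z - d) - cdfr (hi x e y) z +
    (eta / 2 + t * log_barrier3 beta x e y).
  apply: mp => //.
  - by move=> a b c k [a0 b0 c0] /andP[k0 kb]; split; split => //; lra.
  - move=> a b c [a0 b0 c0]; apply: superlinear3_affine; first exact: ltW.
    exact: log_barrier3_superlinear.
  - exists (- 1) => a b c [a0 b0 c0].
    by have [] := bd a b c; have := tB0 _ _ _ a0 b0 c0; lra.
  - move=> eps eps0; exists M => a b c [a0 b0 c0] Ms.
    have [ba bb bc] := B0 _ _ _ a0 b0 c0.
    (* Either every fraction is at least [expR (- t^-1)] and the assumption at infinity applies, or
       [t] times the barrier exceeds 1 and dominates any difference of distribution functions. *)
    have [B_le|B_gt] := leP (log_barrier3 beta a b c) t^-1.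
      have s0 : 0 < a + b + c by lra.
      have := HM a b c a0 b0 c0.
      have ha : expR (- t^-1) * (a + b + c) <= a.
        by apply: log_barrier_le beta0 _ _ _ => //; move: B_le; rewrite /log_barrier3; lra.
      have hb : expR (- t^-1) * (a + b + c) <= b.
        by apply: log_barrier_le beta0 _ _ _ => //; move: B_le; rewrite /log_barrier3; lra.
      have hc : expR (- t^-1) * (a + b + c) <= c.
        by apply: log_barrier_le beta0 _ _ _ => //; move: B_le; rewrite /log_barrier3; lra.
      move=> /(_ ha hb hc Ms).
      by have := tB0 _ _ _ a0 b0 c0; lra.
    have : 1 < t * log_barrier3 beta a b c.
      by move: B_gt; rewrite -[in X in X -> _](ltr_pM2l t0) divff ?gt_eqF.
    by have [] := bd a b c; lra.
have : cdfr (lo x e y) (z - d) <= cdfl (lo x e y) z by apply: cdfr_le_cdfl; lra.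
lra.
Qed.

(** * The harmonic map *)

Lemma integral_supported {R : realType} (beta : R) (mu : probability R R) :
  mu `[0, beta]%classic = 1%E ->
  (\int[mu]_k k%:E = \int[mu]_(k in `[0%R, beta]) k%:E)%E.
Proof.
move=> mu1.
rewrite -(setUv (`[0, beta]%classic : set R)) integral_setU//; last 2 first.
- exact: measurableC.
- by rewrite disj_set2E setICr.
rewrite [X in (_ + X)%E]null_set_integral ?adde0//.
- exact: measurableC.
- have := @probability_setC _ _ _ mu `[0, beta]%classic (measurable_itv _).
  rewrite [X in (1 - X)%E](_ : _ = 1%E); last exact: mu1.
  by rewrite subee.
Qed.

Lemma jump_law_supported {R : realType} (beta : R) (mu : probability R R) :
  supported_on beta mu -> jump_law beta (fine (\int[mu]_k k%:E)%E) mu.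
Proof.
rewrite /supported_on set_mem_set => mu1; split => //.
by rewrite (integral_supported _ _ mu1).
Qed.

Record urn_solution {R : realType} (beta mean : R) (mu nu : probability R R)
    (phi : R -> probability R R) (G : R -> R -> probability R R) : Prop := {
  urn_beta_gt0 : 0 < beta;
  urn_mean_gt0 : 0 < mean;
  urn_law_mu : jump_law beta mean mu;
  urn_law_nu : jump_law beta mean nu;
  urn_phi_continuous : forall t, 0 <= t <= 1 -> forall e : R, 0 < e ->
    exists2 d : R, 0 < d & forall s, 0 <= s <= 1 -> `|s - t| < d ->
      (dW (phi s) (phi t) < e%:E)%E;
  urn_phi_monotone : forall s t, 0 <= s -> s <= t -> t <= 1 ->
    st_le (phi s) (phi t);
  urn_continuous : forall x y, inS x y -> forall e : R, 0 < e ->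
    exists2 d : R, 0 < d & forall x' y', inS x' y' -> `|x' - x| < d ->
      `|y' - y| < d -> (dW (G x' y') (G x y) < e%:E)%E;
  urn_equation : forall x y : R, inS x y -> forall B : set R, measurable B ->
    (x%:E * (\int[mu]_(k in `[0%R, beta]) (G x y B - G (x + k)%R y B))
    + y%:E * (\int[nu]_(k in `[0%R, beta]) (G x y B - G x (y + k)%R B)) = 0)%E;
  urn_infinity : forall e : R, 0 < e -> exists M : R, forall x y, inS x y ->
    M < x + y -> (dW (G x y) (phi (x / (x + y))%R) < e%:E)%E }.

Lemma fine_probability_bound {R : realType} (m : probability R R) (B : set R) :
  measurable B -> `|fine (m B)| <= 1.
Proof.
move=> mB; rewrite ger0_norm; last exact: fine_ge0.
by rewrite -lee_fin fineK ?fin_num_measure// probability_le1.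
Qed.

Lemma lipschitz_max0 {R : realType} (s t : R) :
  `|Num.max s 0 - Num.max t 0| <= `|s - t|.
Proof.
have [s0|s0] := leP s 0; have [t0|t0] := leP t 0; rewrite ?subrr ?normr0//.
- by rewrite ltr0_norm ?ltr0_norm; lra.
- by rewrite gtr0_norm ?gtr0_norm; lra.
Qed.

Lemma lipschitz_min1 {R : realType} (s t : R) :
  `|Num.min s 1 - Num.min t 1| <= `|s - t|.
Proof.
have [s0|s0] := leP s 1; have [t0|t0] := leP t 1; rewrite ?subrr ?normr0//.
- by rewrite ler0_norm ?ltr0_norm; lra.
- by rewrite ger0_norm ?gtr0_norm; lra.
Qed.

Lemma common_radius {R : realType} (P : nat -> R -> Prop) (N : nat) :
  (forall i d d', 0 < d' -> d' <= d -> P i d -> P i d') ->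
  (forall i, (i < N)%N -> exists2 d, 0 < d & P i d) ->
  exists2 d, 0 < d & forall i, (i < N)%N -> P i d.
Proof.
move=> Pdec; elim: N => [|N IH] PN; first by exists 1.
have [d d0 dP] := IH (fun i iN => PN i (ltnW iN)).
have [d' d'0 d'P] := PN N (ltnSn N).
exists (Num.min d d'); first by rewrite lt_min d0.
have m0 : 0 < Num.min d d' by rewrite lt_min d0.
move=> i; rewrite ltnS leq_eqVlt => /orP[/eqP ->|iN].
  by apply: Pdec d'P => //; rewrite ge_min lexx orbT.
by apply: Pdec (dP _ iN) => //; rewrite ge_min lexx.
Qed.

Section urn.
Context {R : realType} {beta mean : R} {mu nu : probability R R}.
Context {phi : R -> probability R R} {G : R -> R -> probability R R}.
Hypothesis U : urn_solution beta mean mu nu phi G.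

Lemma inS_pos (x y : R) : 0 < x -> 0 < y -> inS x y.
Proof.
by move=> x0 y0; split; [lra|split; [lra|move=> [xE _]; move: x0; rewrite xE ltxx]].
Qed.

Lemma cdfr_phi_nincr (s t a : R) : 0 <= s -> s <= t -> t <= 1 ->
  cdfr (phi t) a <= cdfr (phi s) a.
Proof.
move=> s0 st t1; have := urn_phi_monotone _ _ _ _ _ _ U _ _ s0 st t1 a.
by rewrite /Defs.cdf set_mem_set !cdfrE lee_fin.
Qed.

(** The stochastic order compares closed rays; [cdfl] inherits it as a limit from the left. *)
Lemma cdfl_phi_nincr (s t a : R) : 0 <= s -> s <= t -> t <= 1 ->
  cdfl (phi t) a <= cdfl (phi s) a.
Proof.
move=> s0 st t1; apply/ler_addgt0Pr => e e0.
have [d d0 dl] := cdfl_left (phi t) a e e0.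
have : cdfr (phi s) (a - d) <= cdfl (phi s) a by apply: cdfr_le_cdfl; lra.
by have := cdfr_phi_nincr s t (a - d) s0 st t1; lra.
Qed.

Definition clamp01 (t : R) : R := Num.max (Num.min t 1) 0.

Lemma phi_clamp_continuous : dW_continuous (fun t => phi (clamp01 t)).
Proof.
have c01 t : 0 <= clamp01 t <= 1.
  rewrite /clamp01; have [t1|t1] := leP t 1; last by rewrite (max_idPl _)// ler01 lexx.
  by have [t0|t0] := leP t 0; [rewrite lexx ler01|rewrite ltW].
move=> t e e0; have [d d0 dH] := urn_phi_continuous _ _ _ _ _ _ U _ (c01 t) e e0.
exists d => // s st; apply: dH => //; apply: le_lt_trans st.
exact: le_trans (lipschitz_max0 _ _) (lipschitz_min1 _ _).
Qed.

Lemma clamp01_id (t : R) : 0 <= t <= 1 -> clamp01 t = t.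
Proof. by move=> /andP[t0 t1]; rewrite /clamp01 (min_idPl t1) (max_idPl t0). Qed.

Lemma measurable_phi (z : R) :
  measurable_fun (`[0, 1]%classic : set R) (fun t => cdfr (phi t) z - cdfl (phi t) z).
Proof.
apply: (@eq_measurable_fun _ _ _ _ _
  (fun t => cdfr (phi (clamp01 t)) z - cdfl (phi (clamp01 t)) z)).
  by move=> t; rewrite inE/= in_itv/= => t01; rewrite clamp01_id.
apply: measurable_funTS; apply: measurable_funB.
  exact: measurable_cdfr phi_clamp_continuous.
exact: measurable_cdfl phi_clamp_continuous.
Qed.

(** For [t < 0] the argument is frozen at [x], which keeps it in the domain; jumps only see
    [t >= 0]. *)
Lemma G_left_continuous (x y : R) : 0 < x -> 0 < y ->
  dW_continuous (fun t => G (x + Num.max t 0) y).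
Proof.
move=> x0 y0; have pos t : inS (x + Num.max t 0) y.
  by apply: inS_pos => //; rewrite ltr_wpDr// le_max lexx orbT.
move=> t e e0; have [d d0 dH] := urn_continuous _ _ _ _ _ _ U _ _ (pos t) e e0.
exists d => // s st; apply: dH => //; last by rewrite subrr normr0.
rewrite (_ : _ - _ = Num.max s 0 - Num.max t 0); last by ring.
exact: le_lt_trans (lipschitz_max0 _ _) st.
Qed.

Lemma G_right_continuous (x y : R) : 0 < x -> 0 < y ->
  dW_continuous (fun t => G x (y + Num.max t 0)).
Proof.
move=> x0 y0; have pos t : inS x (y + Num.max t 0).
  by apply: inS_pos => //; rewrite ltr_wpDr// le_max lexx orbT.
move=> t e e0; have [d d0 dH] := urn_continuous _ _ _ _ _ _ U _ _ (pos t) e e0.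
exists d => // s st; apply: dH => //; first by rewrite subrr normr0.
rewrite (_ : _ - _ = Num.max s 0 - Num.max t 0); last by ring.
exact: le_lt_trans (lipschitz_max0 _ _) st.
Qed.

Lemma fine_integral_increment (m H0 : probability R R) (H : R -> probability R R) (B : set R) :
  measurable B -> bounded_measurable beta (fun k => fine (H k B)) ->
  (\int[m]_(k in `[0%R, beta]) (H0 B - H k B))%E =
  (- \int[m]_(k in `[0, beta]) (fine (H k B) - fine (H0 B)))%:E.
Proof.
move=> mB bm.
have bm' : bounded_measurable beta (fun k => fine (H0 B) - fine (H k B)).
  by apply: bounded_measurableB bm; exact: bounded_measurable_cst.
have -> : (- \int[m]_(k in `[0, beta]) (fine (H k B) - fine (H0 B)))
    = \int[m]_(k in `[0, beta]) (fine (H0 B) - fine (H k B)).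
  have c := bounded_measurable_cst beta (fine (H0 B)).
  by rewrite !Rintegral_boundedB// opprB.
rewrite fineK; last first.
  apply: integrable_fin_num => //.
  exact: bounded_measurable_integrable bm'.
apply: eq_integral => k _; rewrite EFinB !fineK// fin_num_measure//.
Qed.

Lemma harmonic2_of_measurable (B : set R) : measurable B ->
  (forall x y, 0 < x -> 0 < y ->
    measurable_fun (`[0, beta]%classic : set R) (fun k => fine (G (x + k) y B)) /\
    measurable_fun (`[0, beta]%classic : set R) (fun k => fine (G x (y + k) B))) ->
  harmonic2 beta mu nu (fun x y => fine (G x y B)).
Proof.
move=> mB mG x y x0 y0; have [mG1 mG2] := mG x y x0 y0.
have b1 : bounded_measurable beta (fun k => fine (G (x + k) y B)).
  by split => //; exists 1 => k _; exact: fine_probability_bound.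
have b2 : bounded_measurable beta (fun k => fine (G x (y + k) B)).
  by split => //; exists 1 => k _; exact: fine_probability_bound.
split => //.
have := urn_equation _ _ _ _ _ _ U x y (inS_pos x y x0 y0) B mB.
rewrite (fine_integral_increment _ _ (fun k => G (x + k) y))//.
rewrite (fine_integral_increment _ _ (fun k => G x (y + k)))//.
by rewrite -!EFinM -EFinD => -[]; lra.
Qed.

Lemma measurable_max0 (f : R -> R) :
  measurable_fun setT (fun k : R => f (Num.max k 0)) ->
  measurable_fun (`[0, beta]%classic : set R) f.
Proof.
move=> mf; apply: (@eq_measurable_fun _ _ _ _ _ (fun k : R => f (Num.max k 0))).
  by move=> t; rewrite inE/= in_itv/= => /andP[t0 _]; rewrite (max_idPl t0).
exact: measurable_funTS.
Qed.

Lemma harmonic2_cdfr (a : R) : harmonic2 beta mu nu (fun x y => cdfr (G x y) a).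
Proof.
apply: harmonic2_of_measurable => // x y x0 y0; split.
  apply: (measurable_max0 (fun k => cdfr (G (x + k) y) a)).
  exact: measurable_cdfr (G_left_continuous x y x0 y0).
apply: (measurable_max0 (fun k => cdfr (G x (y + k)) a)).
exact: measurable_cdfr (G_right_continuous x y x0 y0).
Qed.

Lemma harmonic2_cdfl (a : R) : harmonic2 beta mu nu (fun x y => cdfl (G x y) a).
Proof.
apply: harmonic2_of_measurable => // x y x0 y0; split.
  apply: (measurable_max0 (fun k => cdfl (G (x + k) y) a)).
  exact: measurable_cdfl (G_left_continuous x y x0 y0).
apply: (measurable_max0 (fun k => cdfl (G x (y + k)) a)).
exact: measurable_cdfl (G_right_continuous x y x0 y0).
Qed.

(** Makes the gap uniform. By monotonicity, parameters at distance [rho] are compared through two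
    consecutive points of a grid lying between them; there are finitely many such pairs, and
    one-sided continuity gives each its own [d]. *)
Lemma phi_gap (z : R) :
  (forall t' t, 0 <= t' -> t' < t -> t <= 1 -> cdfr (phi t) z <= cdfl (phi t') z) ->
  forall rho eta, 0 < rho -> 0 < eta -> exists2 d, 0 < d &
    forall t' t, 0 <= t' -> t <= 1 -> t' + rho <= t ->
      cdfr (phi t) (z + d) <= cdfr (phi t') (z - d) + eta.
Proof.
move=> gap rho eta rho0 eta0.
have [N0] := @ltr_add_invr R 0 (rho / 2) ltac:(lra); rewrite add0r => N0rho.
pose N := N0.+1; have N_gt0 : 0 < N%:R :> R by rewrite ltr0n.
pose t_ i : R := i%:R / N%:R.
pose P i d := (i.+1 <= N)%N ->
  cdfr (phi (t_ i.+1)) (z + d) <= cdfr (phi (t_ i)) (z - d) + eta.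
have t_ge0 i : 0 <= t_ i by rewrite divr_ge0.
have t_le1 i : (i <= N)%N -> t_ i <= 1 by move=> iN; rewrite ler_pdivrMr// mul1r ler_nat.
have t_lt i : t_ i < t_ i.+1 by rewrite ltr_pM2r ?invr_gt0// ltr_nat.
have [i d d' d'0 dd' Pd iN|i iN|d d0 HP] := @common_radius R P N.
- have : cdfr (phi (t_ i.+1)) (z + d') <= cdfr (phi (t_ i.+1)) (z + d).
    by apply: cdfr_mono; lra.
  have : cdfr (phi (t_ i)) (z - d) <= cdfr (phi (t_ i)) (z - d').
    by apply: cdfr_mono; lra.
  by have := Pd iN; lra.
- have [d1 d10 h1] := cdfr_right (phi (t_ i.+1)) z (eta / 2) ltac:(lra).
  have [d2 d20 h2] := cdfl_left (phi (t_ i)) z (eta / 2) ltac:(lra).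
  have h := gap _ _ (t_ge0 i) (t_lt i) (t_le1 _ iN).
  exists (Num.min d1 d2); first by rewrite lt_min d10.
  have m1 : Num.min d1 d2 <= d1 by rewrite ge_min lexx.
  have m2 : Num.min d1 d2 <= d2 by rewrite ge_min lexx orbT.
  move=> _.
  have : cdfr (phi (t_ i.+1)) (z + Num.min d1 d2) <= cdfr (phi (t_ i.+1)) (z + d1).
    by apply: cdfr_mono; lra.
  have : cdfr (phi (t_ i)) (z - d2) <= cdfr (phi (t_ i)) (z - Num.min d1 d2).
    by apply: cdfr_mono; lra.
  lra.
exists d => // t' t t'0 t1 t't.
have /andP[tr1 tr2] := truncn_itv (mulr_ge0 (ltW N_gt0) t'0).
(* The first grid point strictly beyond [t']; as the mesh is below [rho / 2], the next grid point is
   still at most [t]. *)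
set i := (Num.Def.trunc (N%:R * t')).+1 in tr2.
have ti : t' <= t_ i by rewrite ler_pdivlMr// mulrC ltW.
have tN : N%:R * t' + 2 <= N%:R * t.
  have : N%:R * (t' + rho) <= N%:R * t by rewrite ler_pM2l.
  have : N%:R * (N%:R^-1) <= N%:R * (rho / 2) by rewrite ler_pM2l// ltW.
  by rewrite divff ?gt_eqF// mulrDr; lra.
have i1 : i.+1%:R <= N%:R * t.
  by apply: le_trans tN; rewrite /i -2!natr1; move: tr1; lra.
have ti1 : t_ i.+1 <= t by rewrite ler_pdivrMr// mulrC.
have iN : (i.+1 <= N)%N.
  rewrite -(ler_nat R); apply: le_trans i1 _.
  by rewrite ler_piMr// ltW.
have := HP i iN iN.
have := cdfr_phi_nincr _ _ (z + d) (t_ge0 _) ti1 t1.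
have := cdfr_phi_nincr _ _ (z - d) t'0 ti (t_le1 _ (ltnW iN)).
lra.
Qed.

(** Far away [G] is close to [phi] in direction. Half of the shift [d] from [phi_gap] is spent on
    each of the two points, and [eta] splits as [1/2 + 1/4 + 1/4]. *)
Lemma G_gap (z : R) :
  (forall t' t, 0 <= t' -> t' < t -> t <= 1 -> cdfr (phi t) z <= cdfl (phi t') z) ->
  forall rho eta, 0 < rho -> 0 < eta -> exists2 d, 0 < d & exists M,
    forall x y x' y', 0 < x -> 0 < y -> 0 < x' -> 0 < y' ->
      M < x + y -> M < x' + y' -> x' / (x' + y') + rho <= x / (x + y) ->
      cdfr (G x y) z <= cdfr (G x' y') (z - d) + eta.
Proof.
move=> gap rho eta rho0 eta0.
have [d d0 dP] := phi_gap z gap rho (eta / 2) rho0 ltac:(lra).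
pose d' := d / 2; have d'0 : 0 < d' by rewrite /d'; lra.
exists d' => //.
have [M HM] := urn_infinity _ _ _ _ _ _ U (eta / 4 * d') ltac:(rewrite mulr_gt0//; lra).
exists M => x y x' y' x0 y0 x'0 y'0 Mxy Mxy' th.
have [h1 _] := dW_cdfr _ _ _ _ z (HM _ _ (inS_pos _ _ x0 y0) Mxy) d'0.
have [_ h2] := dW_cdfr _ _ _ _ (z - d) (HM _ _ (inS_pos _ _ x'0 y'0) Mxy') d'0.
have /andP[_ t1] := fraction_in01 x y x0 y0.
have /andP[t'0 _] := fraction_in01 x' y' x'0 y'0.
have := dP _ _ t'0 t1 th.
rewrite mulfK ?gt_eqF// in h1 h2.
have E : z - d + d' = z - d' by rewrite /d'; field.
rewrite E in h2.
have : cdfr (phi (x / (x + y))) (z + d') <= cdfr (phi (x / (x + y))) (z + d).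
  by apply: cdfr_mono; rewrite /d'; lra.
lra.
Qed.

(** Adding [e] to the first colour raises its fraction, so at infinity the gap of [phi] orders the
    two functions; comparison in the three-colour urn extends this to the quadrant. *)
Lemma cdfr_le_cdfl_left (z : R) :
  (forall t' t, 0 <= t' -> t' < t -> t <= 1 -> cdfr (phi t) z <= cdfl (phi t') z) ->
  forall x e y, 0 < x -> 0 < e -> 0 < y -> cdfr (G (x + e) y) z <= cdfl (G x y) z.
Proof.
move=> gap; have [[[beta0 mean0] jmu] jnu] := (ltW (urn_beta_gt0 _ _ _ _ _ _ U),
  urn_mean_gt0 _ _ _ _ _ _ U, urn_law_mu _ _ _ _ _ _ U, urn_law_nu _ _ _ _ _ _ U).
apply: (cdfr_le_cdfl_of_infinity beta mean z mu mu nu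
  (fun x _ y => G x y) (fun x e y => G (x + e) y)) => //.
  move=> d; apply: harmonic3B.
    exact: (harmonic3_skip_left _ _ _ _ (harmonic2_cdfr _)).
  exact: (harmonic3_merge_left _ _ _ _ (harmonic2_cdfr _)).
move=> rho eta rho0 eta0.
(* The fraction grows by [e / (x + e + y)] times [y / (x + y)], and both factors are at least
   [rho]. *)
have [d d0 [M HM]] := G_gap z gap (rho ^+ 2) eta ltac:(rewrite exprn_gt0//) eta0.
(* Since [x >= rho * (x + e + y)], this threshold forces [x + y > M] even without the extra
   colour. *)
exists d => //; exists (Num.max M 0 / rho) => x e y x0 e0 y0 rx re ry.
rewrite ltr_pdivrMr// mulrC => Ms.
have M1 : M <= Num.max M 0 by rewrite le_max lexx.
have s0 : 0 < x + e + y by lra.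
apply: HM => //; try lra.
rewrite -lerBrDl (_ : _ - _ = (e / (x + e + y)) * (y / (x + y))); last first.
  by field; rewrite !gt_eqF//; lra.
rewrite expr2 ler_pM ?(ltW rho0)//.
  by rewrite ler_pdivlMr.
rewrite ler_pdivlMr; last lra.
by apply: le_trans ry; rewrite ler_pM2l//; lra.
Qed.

Lemma cdfr_le_cdfl_right (z : R) :
  (forall t' t, 0 <= t' -> t' < t -> t <= 1 -> cdfr (phi t) z <= cdfl (phi t') z) ->
  forall x e y, 0 < x -> 0 < e -> 0 < y -> cdfr (G x y) z <= cdfl (G x (e + y)) z.
Proof.
move=> gap; have [[[beta0 mean0] jmu] jnu] := (ltW (urn_beta_gt0 _ _ _ _ _ _ U),
  urn_mean_gt0 _ _ _ _ _ _ U, urn_law_mu _ _ _ _ _ _ U, urn_law_nu _ _ _ _ _ _ U).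
apply: (cdfr_le_cdfl_of_infinity beta mean z mu nu nu
  (fun x e y => G x (e + y)) (fun x _ y => G x y)) => //.
  move=> d; apply: harmonic3B.
    exact: (harmonic3_merge_right _ _ _ _ (harmonic2_cdfr _)).
  exact: (harmonic3_skip_right _ _ _ _ (harmonic2_cdfr _)).
move=> rho eta rho0 eta0.
have [d d0 [M HM]] := G_gap z gap (rho ^+ 2) eta ltac:(rewrite exprn_gt0//) eta0.
exists d => //; exists (Num.max M 0 / rho) => x e y x0 e0 y0 rx re ry.
rewrite ltr_pdivrMr// mulrC => Ms.
have M1 : M <= Num.max M 0 by rewrite le_max lexx.
have s0 : 0 < x + e + y by lra.
apply: HM => //; try lra.
rewrite -lerBrDl (_ : _ - _ = (e / (x + e + y)) * (x / (x + y))); last first.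
  by field; rewrite !gt_eqF//; lra.
rewrite expr2 ler_pM ?(ltW rho0)//.
  by rewrite ler_pdivlMr.
rewrite ler_pdivlMr; last lra.
by apply: le_trans rx; rewrite ler_pM2l//; lra.
Qed.

End urn.

(** * Atoms *)

(** If [f] were below the asserted level at every [k > 0], then [f - f0] would lie under
    [eps + A * (mean / 2 - k)], whose integral [eps - A * mean / 2] is below [- eps]. *)
Lemma near_max_jump {R : realType} (beta mean M eps f0 : R) (m : probability R R)
    (f : R -> R) :
  0 < beta -> 0 < mean -> 0 < eps -> jump_law beta mean m ->
  bounded_measurable beta f -> (forall k, 0 <= k <= beta -> f k <= M) ->
  M - eps <= f0 -> - eps <= \int[m]_(k in `[0, beta]) (f k - f0) ->
  exists2 k, 0 < k & M - (4 * beta / mean + 1) * eps <= f k.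
Proof.
move=> beta0 mean0 eps0 jm bf fM Mf0 If; apply: contrapT => nex.
have {}nex k : 0 < k -> f k < M - (4 * beta / mean + 1) * eps.
  by move=> k0; rewrite ltNge; apply/negP => h; apply: nex; exists k.
set C := 4 * beta / mean + 1 in nex.
have C0 : 0 < C by rewrite /C addr_gt0// divr_gt0//; lra.
(* The slope for which a drop of [C * eps] is spread over the length [beta]. *)
pose A := C * eps / beta.
have A0 : 0 < A by rewrite divr_gt0// mulr_gt0.
have : \int[m]_(k in `[0, beta]) (f k - f0) <= (eps + A * (mean / 2)) + (- A) * mean.
  apply: Rintegral_le_affine jm _ _.
    exact: bounded_measurableB bf (bounded_measurable_cst _ _).
  move=> k /andP[k0 kb].
  have [km|km] := leP k (mean / 2).
    have : A * k <= A * (mean / 2) by rewrite ler_pM2l.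
    have : f k <= M by apply: fM; rewrite k0.
    lra.
  have : f k < M - C * eps by apply: nex; lra.
  have : A * (k - mean / 2) <= A * beta by rewrite ler_pM2l//; lra.
  have -> : A * beta = C * eps by rewrite /A divfK ?gt_eqF.
  by rewrite mulrBr; lra.
have : A * (mean / 2) = 2 * eps + eps * mean / (2 * beta).
  by rewrite /A /C; field; rewrite !gt_eqF.
have : 0 < eps * mean / (2 * beta) by rewrite divr_gt0 ?mulr_gt0//.
lra.
Qed.

(** A nonnegative function with zero integral vanishes almost everywhere. If it had no zero in
    [[mean/2, beta]], the positive part of [k - mean / 2] would vanish almost everywhere too,
    although its integral is at least [mean / 2]. *)
Lemma zero_jump {R : realType} (beta mean : R) (m : probability R R) (f : R -> R) :
  0 < mean -> jump_law beta mean m -> bounded_measurable beta f ->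
  (forall k, 0 <= k <= beta -> 0 <= f k) ->
  \int[m]_(k in `[0, beta]) f k = 0 ->
  exists2 k, mean / 2 <= k <= beta & f k = 0.
Proof.
move=> mean0 jm bf f0 If; apply: contrapT => nex.
have {}nex k : mean / 2 <= k <= beta -> f k <> 0.
  by move=> kb fk; apply: nex; exists k.
have mf : measurable_fun (`[0, beta]%classic : set R) (EFin \o f).
  by apply/measurable_EFinP; exact: bf.1.
have : ae_eq m (`[0, beta]%classic : set R) (EFin \o f) (cst 0%E).
  apply/ae_eq_integral_abs => //.
  transitivity (\int[m]_(k in `[0%R, beta]) (f k)%:E)%E.
    apply: eq_integral => k; rewrite inE/= in_itv/= => kb.
    by rewrite ger0_norm// f0.
  have fin : (\int[m]_(k in `[0%R, beta]) (f k)%:E)%E \is a fin_num.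
    by apply: integrable_fin_num => //; exact: bounded_measurable_integrable bf.
  by rewrite -[LHS]fineK//; congr EFin; exact: If.
pose g (k : R) := Num.max (k - mean / 2) 0.
have mg : measurable_fun (`[0, beta]%classic : set R) g.
  by apply: measurable_maxr => //; apply: measurable_funB.
have bg : bounded_measurable beta g.
  split => //; exists (beta + mean) => k /andP[k0 kb].
  rewrite /g; have [h|h] := leP (k - mean / 2) 0; first by rewrite normr0; lra.
  by rewrite gtr0_norm//; lra.
move=> aef.
have aeg : ae_eq m (`[0, beta]%classic : set R) (EFin \o g) (cst 0%E).
  move: aef; apply: filterS => k /= H kb; have fk := H kb.
  rewrite /g; have [//|h] := leP (k - mean / 2) 0.
  move: kb; rewrite in_itv/= => /andP[k0 kb].
  by exfalso; apply: (nex k); [apply/andP; split; lra|case: fk].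
have Ig : \int[m]_(k in `[0, beta]) g k = 0.
  rewrite /Rintegral.
  rewrite (ae_eq_integral (cst 0%E) (EFin \o g) _ _ _ aeg)//.
    by rewrite integral0.
  by apply/measurable_EFinP.
have : - (mean / 2) + 1 * mean <= \int[m]_(k in `[0, beta]) g k.
  apply: Rintegral_ge_affine jm bg _ => k _.
  by rewrite /g le_max; apply/orP; left; lra.
rewrite Ig; lra.
Qed.

Section atoms.
Context {R : realType} {beta mean : R} {mu nu : probability R R}.
Context {phi : R -> probability R R} {G : R -> R -> probability R R}.
Hypothesis U : urn_solution beta mean mu nu phi G.
Variable z : R.

Definition atom (x y : R) : R := cdfr (G x y) z - cdfl (G x y) z.

Lemma atom_ge0 (x y : R) : 0 <= atom x y.
Proof. by rewrite subr_ge0 cdfl_le_cdfr. Qed.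

Lemma atom_le1 (x y : R) : atom x y <= 1.
Proof. by rewrite lerBlDr; have := cdfr_le1 (G x y) z; have := cdfl_ge0 (G x y) z; lra. Qed.

Lemma harmonic2_atom : harmonic2 beta mu nu atom.
Proof. exact: harmonic2B (harmonic2_cdfr U z) (harmonic2_cdfl U z). Qed.

Let beta0 := urn_beta_gt0 _ _ _ _ _ _ U.
Let mean0 := urn_mean_gt0 _ _ _ _ _ _ U.
Let jmu := urn_law_mu _ _ _ _ _ _ U.
Let jnu := urn_law_nu _ _ _ _ _ _ U.

(** * Vanishing of the atoms under the gap condition *)

Section gap.
Hypothesis gap : forall t' t, 0 <= t' -> t' < t -> t <= 1 ->
  cdfr (phi t) z <= cdfl (phi t') z.
Variable M : R.
Hypothesis M0 : 0 < M.
Hypothesis atomM : forall x y, 0 < x -> 0 < y -> atom x y <= M.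

Let C := 4 * beta / mean + 1.

Let C1 : 1 <= C.
Proof. by rewrite /C lerDr divr_ge0 ?(ltW mean0)// mulr_ge0// ltW. Qed.

(** The jumps in [y] gain at most [eps]. Since [y <= x], harmonicity then bounds the mean loss of
    the jumps in [x] by [eps]. The condition [y <= x] survives a jump in [x], so the step can be
    iterated. *)
Lemma near_max_left (x y eps : R) : 0 < y -> y <= x -> 0 < eps ->
  M - eps <= atom x y -> exists2 k, 0 < k & M - C * eps <= atom (x + k) y.
Proof.
move=> y0 yx eps0 Mu; have x0 : 0 < x by lra.
have [b1 b2 E] := harmonic2_atom _ _ x0 y0.
apply: (near_max_jump beta mean M eps (atom x y) mu (fun k => atom (x + k) y)) => //.
  by move=> k /andP[k0 _]; apply: atomM => //; lra.
have I2 : \int[nu]_(k in `[0, beta]) (atom x (y + k) - atom x y) <= eps + 0 * mean.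
  apply: Rintegral_le_affine jnu _ _.
    exact: bounded_measurableB b2 (bounded_measurable_cst _ _).
  by move=> k /andP[k0 _]; have := atomM x (y + k) x0 ltac:(lra); lra.
rewrite mul0r addr0 -(ler_pM2l y0) in I2.
rewrite -(ler_pM2l x0).
have : y * eps <= x * eps by rewrite ler_pM2r.
lra.
Qed.

Lemma near_max_right (x y eps : R) : 0 < x -> x <= y -> 0 < eps ->
  M - eps <= atom x y -> exists2 k, 0 < k & M - C * eps <= atom x (y + k).
Proof.
move=> x0 xy eps0 Mu; have y0 : 0 < y by lra.
have [b1 b2 E] := harmonic2_atom _ _ x0 y0.
apply: (near_max_jump beta mean M eps (atom x y) nu (fun k => atom x (y + k))) => //.
  by move=> k /andP[k0 _]; apply: atomM => //; lra.
have I2 : \int[mu]_(k in `[0, beta]) (atom (x + k) y - atom x y) <= eps + 0 * mean.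
  apply: Rintegral_le_affine jmu _ _.
    exact: bounded_measurableB b1 (bounded_measurable_cst _ _).
  by move=> k /andP[k0 _]; have := atomM (x + k) y ltac:(lra) y0; lra.
rewrite mul0r addr0 -(ler_pM2l x0) in I2.
rewrite -(ler_pM2l y0).
have : x * eps <= y * eps by rewrite ler_pM2r.
lra.
Qed.

Let expC_ge (n : nat) (eps : R) : 0 < eps -> C ^+ n * eps <= M / 2 -> eps <= M / 2.
Proof.
move=> eps0; apply: le_trans; rewrite ler_peMl ?(ltW eps0)//.
exact: exprn_ege1.
Qed.

(** By [cdfr_le_cdfl_left], the distribution function at [(x, y)] is at least the atom there plus
    the distribution function after a jump. Each jump multiplies the deficit by [C], so all [n + 1]
    atoms collected are at least [M / 2]. *)
Lemma cdfr_ge_of_near_max (n : nat) (x y eps : R) : 0 < y -> y <= x -> 0 < eps ->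
  C ^+ n * eps <= M / 2 -> M - eps <= atom x y ->
  n.+1%:R * (M / 2) <= cdfr (G x y) z.
Proof.
elim: n x eps => [|n IH] x eps y0 yx eps0 Ceps Mu.
  rewrite expr0 mul1r in Ceps; rewrite mul1r.
  by have := cdfl_ge0 (G x y) z; move: Mu; rewrite /atom; lra.
have [k k0 Mk] := near_max_left x y eps y0 yx eps0 Mu.
have C0 : 0 < C by apply: lt_le_trans C1.
have := IH (x + k) (C * eps) y0 ltac:(lra) (mulr_gt0 C0 eps0).
rewrite mulrA -exprSr => /(_ Ceps Mk) IHk.
have := cdfr_le_cdfl_left U z gap x k y ltac:(lra) k0 y0.
have := expC_ge _ _ eps0 Ceps.
rewrite -(natr1 n.+1) mulrDl mul1r; move: Mu; rewrite /atom.
set q := _ * (M / 2) in IHk *; move: IHk; lra.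
Qed.

Lemma cdfl_le_of_near_max (n : nat) (x y eps : R) : 0 < x -> x <= y -> 0 < eps ->
  C ^+ n * eps <= M / 2 -> M - eps <= atom x y ->
  n.+1%:R * (M / 2) <= 1 - cdfl (G x y) z.
Proof.
elim: n y eps => [|n IH] y eps x0 xy eps0 Ceps Mu.
  rewrite expr0 mul1r in Ceps; rewrite mul1r.
  by have := cdfr_le1 (G x y) z; move: Mu; rewrite /atom; lra.
have [k k0 Mk] := near_max_right x y eps x0 xy eps0 Mu.
have C0 : 0 < C by apply: lt_le_trans C1.
have := IH (y + k) (C * eps) x0 ltac:(lra) (mulr_gt0 C0 eps0).
rewrite mulrA -exprSr => /(_ Ceps Mk) IHk.
have := cdfr_le_cdfl_right U z gap x k y x0 k0 ltac:(lra).
rewrite (addrC k).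
have := expC_ge _ _ eps0 Ceps.
rewrite -(natr1 n.+1) mulrDl mul1r; move: Mu; rewrite /atom.
set q := _ * (M / 2) in IHk *; move: IHk; lra.
Qed.

Lemma near_max_false : ~ (forall eps, 0 < eps ->
  exists x y, [/\ 0 < x, 0 < y & M - eps <= atom x y]).
Proof.
move=> near.
have C0 : 0 < C by apply: lt_le_trans C1.
(* Enough jumps for the collected atoms to exceed total mass 1. *)
pose n := Num.Def.trunc (2 / M).
have nM : 1 < n.+1%:R * (M / 2).
  have /andP[_] := truncn_itv (divr_ge0 (ler0n R 2) (ltW M0)).
  by rewrite -/n ltr_pdivrMr// mulrA ltr_pdivlMr// mul1r.
pose eps := M / 2 / C ^+ n.
have eps0 : 0 < eps by apply: divr_gt0; [exact: divr_gt0|exact: exprn_gt0].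
have Ceps : C ^+ n * eps <= M / 2 by rewrite /eps mulrC divfK// gt_eqF// exprn_gt0.
have [x [y [x0 y0 Mu]]] := near eps eps0.
have [yx|xy] := leP y x.
  have := cdfr_ge_of_near_max n x y eps y0 yx eps0 Ceps Mu.
  by have := cdfr_le1 (G x y) z; lra.
have := cdfl_le_of_near_max n x y eps x0 (ltW xy) eps0 Ceps Mu.
by have := cdfl_ge0 (G x y) z; lra.
Qed.

End gap.

Lemma atom_eq0_of_gap :
  (forall t' t, 0 <= t' -> t' < t -> t <= 1 -> cdfr (phi t) z <= cdfl (phi t') z) ->
  forall x y, 0 < x -> 0 < y -> atom x y = 0.
Proof.
move=> gap x y x0 y0; apply/eqP; rewrite eq_le atom_ge0 andbT leNgt.
apply/negP => axy.
pose S := [set r : R | exists x y, [/\ 0 < x, 0 < y & r = atom x y]].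
have Ssup : has_sup S.
  split; first by exists (atom x y), x, y.
  by exists 1 => _ [x' [y' [_ _ ->]]]; exact: atom_le1.
have SM x' y' : 0 < x' -> 0 < y' -> atom x' y' <= sup S.
  by move=> x'0 y'0; apply: ub_le_sup; [exact: Ssup.2|exists x', y'].
apply: (near_max_false gap (sup S) (lt_le_trans axy (SM _ _ x0 y0)) SM).
move=> eps eps0; have [_ [x' [y' [x'0 y'0 ->]]] h] := sup_adherent eps0 Ssup.
by exists x', y'; split => //; exact: ltW.
Qed.

(** * Positivity of the atoms when the gap condition fails *)

Section jump.
Variables a b c : R.
Hypothesis a0 : 0 <= a.
Hypothesis ab : a < b.
Hypothesis b1 : b <= 1.
Hypothesis c0 : 0 < c.
Hypothesis jump : cdfl (phi a) z + c <= cdfr (phi b) z.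

Let t0 := (a + b) / 2.
Let r := (b - a) / 2.
Let r0 : 0 < r. Proof. by rewrite divr_gt0// subr_gt0. Qed.
Let t01 : 0 <= t0 <= 1.
Proof. by move: a0 ab b1; rewrite /t0 => *; apply/andP; split; lra. Qed.

(** By monotonicity every [phi t] with [t] in [[a, b]] has an atom of mass at least [c] at [z]. At
    infinity the window mass is thus nearly [c] in directions within [r] of [t0], and in the others
    the scaled barrier is at least [c]; the maximum principle brings the bound inside. *)
Lemma cdfr_window_ge (d x y : R) : 0 < d -> 0 < x -> 0 < y ->
  c - c / r ^+ 2 * square_barrier beta t0 x y <=
  cdfr (G x y) (z + d) - cdfr (G x y) (z - d).
Proof.
move=> d0 x0 y0.
have cr0 : 0 < c / r ^+ 2 by rewrite divr_gt0// exprn_gt0.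
have sq0 X Y : 0 < X -> 0 < Y -> 0 <= 6 * beta / (X + Y).
  by move=> X0 Y0; rewrite divr_ge0 ?mulr_ge0 ?(ltW beta0)//; lra.
have win x' y' : 0 <= cdfr (G x' y') (z + d) - cdfr (G x' y') (z - d).
  by rewrite subr_ge0; apply: cdfr_mono; lra.
have bar X Y : 0 < X -> 0 < Y -> 0 <= c / r ^+ 2 * square_barrier beta t0 X Y.
  move=> X0 Y0; rewrite mulr_ge0 ?(ltW cr0)// addr_ge0 ?sqr_ge0//.
  exact: sq0.
have := maximum_principle beta mean mu mu nu
  (fun x e y => [/\ 0 < x, 0 < e & 0 < y])
  (fun x e y => cdfr (G (x + e) y) (z + d) - cdfr (G (x + e) y) (z - d))
  (fun x e y => - c + c / r ^+ 2 * square_barrier beta t0 (x + e) y)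
  mean0 (ltW beta0) jmu jmu jnu.
(* The first colour is split into two equal halves so that the three-colour principle applies to a
   two-colour function. *)
move=> mp; have {mp} : 0 <= cdfr (G (x / 2 + x / 2) y) (z + d) -
    cdfr (G (x / 2 + x / 2) y) (z - d) +
    (- c + c / r ^+ 2 * square_barrier beta t0 (x / 2 + x / 2) y).
  apply: mp; last by split; lra.
  - by [].
  - by move=> x' e' y' k [x'0 e'0 y'0] /andP[k0 kb]; split; split => //; lra.
  - exact: (harmonic3_merge_left _ _ _ _
      (harmonic2B _ _ _ _ _ (harmonic2_cdfr U _) (harmonic2_cdfr U _))).
  - move=> x' e' y' [x'0 e'0 y'0].
    apply: (superlinear3_affine beta (- c) (c / r ^+ 2)
      (fun x e y => square_barrier beta t0 (x + e) y)); first exact: ltW.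
    exact: square_barrier_superlinear.
  - exists (- c) => x' e' y' [x'0 e'0 y'0].
    have := bar (x' + e') y' ltac:(lra) y'0.
    by have := win (x' + e') y'; lra.
  - move=> eps eps0.
    have d20 : 0 < d / 2 by lra.
    have [M HM] := urn_infinity _ _ _ _ _ _ U (eps / 4 * (d / 2))
      ltac:(rewrite mulr_gt0//; lra).
    exists M => x' e' y' [x'0 e'0 y'0] Ms.
    pose X := x' + e'; have X0 : 0 < X by rewrite /X; lra.
    rewrite -/X; rewrite -/X in Ms.
    have dWX := HM X y' (inS_pos X y' X0 y'0) Ms.
    set th := X / (X + y') in dWX.
    have [_ h1] := dW_cdfr _ _ _ _ (z + d / 2) dWX d20.
    have [h2 _] := dW_cdfr _ _ _ _ (z - d) dWX d20.
    rewrite mulfK ?gt_eqF// in h1 h2.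
    have E1 : z + d / 2 + d / 2 = z + d by field.
    have E2 : z - d + d / 2 = z - d / 2 by field.
    rewrite E1 in h1; rewrite E2 in h2.
    have g0 := win X y'.
    have q0 := bar X y' X0 y'0.
    have [thr|thr] := leP `|th - t0| r.
      move: a0 ab b1 jump thr => ? ? ? ?; rewrite ler_norml => /andP[thl thr].
      have tha : a <= th by move: thl; rewrite /t0 /r; lra.
      have thb : th <= b by move: thr; rewrite /t0 /r; lra.
      have := cdfr_phi_nincr U th b z ltac:(lra) thb ltac:(lra).
      have := cdfl_phi_nincr U a th z ltac:(lra) tha ltac:(lra).
      have : cdfr (phi th) z <= cdfr (phi th) (z + d / 2) by apply: cdfr_mono; lra.
      have : cdfr (phi th) (z - d / 2) <= cdfl (phi th) z by apply: cdfr_le_cdfl; lra.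
      lra.
    have : r ^+ 2 <= square_barrier beta t0 X y'.
      rewrite /square_barrier -/th; apply: ler_wpDr; first exact: sq0.
      by rewrite -(real_normK (num_real (th - t0))) ler_sqr ?nnegrE// ltW.
    rewrite -(ler_pM2l cr0) divfK ?gt_eqF ?exprn_gt0//.
    lra.
rewrite -splitr; lra.
Qed.

Lemma atom_ge (x y : R) : 0 < x -> 0 < y ->
  c - c / r ^+ 2 * square_barrier beta t0 x y <= atom x y.
Proof.
move=> x0 y0; apply/ler_addgt0Pr => eta eta0.
have [d1 d10 h1] := cdfr_right (G x y) z (eta / 2) ltac:(lra).
have [d2 d20 h2] := cdfl_left (G x y) z (eta / 2) ltac:(lra).
pose d := Num.min d1 d2.
have d0 : 0 < d by rewrite lt_min d10.
have m1 : d <= d1 by rewrite ge_min lexx.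
have m2 : d <= d2 by rewrite ge_min lexx orbT.
have := cdfr_window_ge d x y d0 x0 y0.
have : cdfr (G x y) (z + d) <= cdfr (G x y) (z + d1) by apply: cdfr_mono; lra.
have : cdfr (G x y) (z - d2) <= cdfr (G x y) (z - d) by apply: cdfr_mono; lra.
rewrite /atom; lra.
Qed.

(** At a zero, harmonicity makes a sum of two nonnegative terms vanish, so each integral is zero and
    [zero_jump] applies in both directions. *)
Lemma atom_zero_jump (x y : R) : 0 < x -> 0 < y -> atom x y = 0 ->
  (exists2 k, mean / 2 <= k <= beta & atom (x + k) y = 0) /\
  (exists2 k, mean / 2 <= k <= beta & atom x (y + k) = 0).
Proof.
move=> x0 y0 u0; have [m1 m2 E] := harmonic2_atom _ _ x0 y0.
rewrite u0 in E.
have E1 (m : probability R R) f : \int[m]_(k in `[0, beta]) (f k - 0) =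
    \int[m]_(k in `[0, beta]) f k.
  by apply: eq_Rintegral => k _; rewrite subr0.
rewrite !E1 in E.
have I1 : 0 <= \int[mu]_(k in `[0, beta]) atom (x + k) y.
  by apply: Rintegral_ge0 => k _; exact: atom_ge0.
have I2 : 0 <= \int[nu]_(k in `[0, beta]) atom x (y + k).
  by apply: Rintegral_ge0 => k _; exact: atom_ge0.
have J1 := mulr_ge0 (ltW x0) I1; have J2 := mulr_ge0 (ltW y0) I2.
split.
  apply: (zero_jump beta mean mu (fun k => atom (x + k) y)) => //.
    by move=> k _; exact: atom_ge0.
  have /eqP : x * \int[mu]_(k in `[0, beta]) atom (x + k) y = 0 by lra.
  by rewrite mulf_eq0 (gt_eqF x0) => /eqP.
apply: (zero_jump beta mean nu (fun k => atom x (y + k))) => //.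
  by move=> k _; exact: atom_ge0.
have /eqP : y * \int[nu]_(k in `[0, beta]) atom x (y + k) = 0 by lra.
by rewrite mulf_eq0 (gt_eqF y0) => /eqP.
Qed.

(** Zeros are followed by jumping in [y] when [(1 - t0) * x - t0 * y] is nonnegative and in [x]
    otherwise. This quantity changes by at most [beta] towards the opposite sign, so it stays
    bounded while the total grows by at least [mean / 2]. *)
Lemma atom_zero_path (x y : R) (n : nat) : 0 < x -> 0 < y -> atom x y = 0 ->
  exists x' y', [/\ 0 < x', 0 < y', atom x' y' = 0, n%:R * (mean / 2) <= x' + y' &
    `|(1 - t0) * x' - t0 * y'| <= Num.max `|(1 - t0) * x - t0 * y| beta].
Proof.
move=> x0 y0 u0; set K := Num.max _ _.
have Kb : beta <= K by rewrite le_max lexx orbT.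
have /andP[t00 t0_le1] := t01.
elim: n => [|n [x' [y' [x'0 y'0 u'0 ns dK]]]].
  by exists x, y; split => //; [rewrite mul0r; lra|rewrite le_max lexx].
have [[k /andP[k1 k2] uk] [l /andP[l1 l2] ul]] := atom_zero_jump _ _ x'0 y'0 u'0.
have m20 : 0 < mean / 2 by rewrite divr_gt0.
move: dK; rewrite ler_norml => /andP[dK1 dK2].
have [d0|d0] := leP 0 ((1 - t0) * x' - t0 * y').
  exists x', (y' + l); split => //; first lra.
    by rewrite -natr1 mulrDl; lra.
  have : t0 * l <= 1 * l by rewrite ler_wpM2r//; lra.
  have : 0 <= t0 * l by rewrite mulr_ge0//; lra.
  by rewrite mulrDr ler_norml; lra.
exists (x' + k), y'; split => //; first lra.
  by rewrite -natr1 mulrDl; lra.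
have : (1 - t0) * k <= 1 * k by rewrite ler_wpM2r//; lra.
have : 0 <= (1 - t0) * k by rewrite mulr_ge0//; lra.
by rewrite (mulrDr (1 - t0)) ler_norml; lra.
Qed.

Lemma atom_gt0_of_jump (x y : R) : 0 < x -> 0 < y -> 0 < atom x y.
Proof.
move=> x0 y0; rewrite lt_def atom_ge0 andbT; apply/eqP => u0.
pose K := Num.max `|(1 - t0) * x - t0 * y| beta.
have K0 : 0 < K by rewrite lt_max beta0 orbT.
(* Beyond the first summand the fraction is within [r / 2] of [t0]; beyond the second, the
   correction is at most [r^2 / 4]. Hence the barrier is at most [r^2 / 2], and [atom_ge] is
   strictly positive. *)
pose B := 2 * K / r + 24 * beta / r ^+ 2.
have B1 : 0 < 2 * K / r.
  by apply: divr_gt0 => //; exact: mulr_gt0.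
have B2 : 0 < 24 * beta / r ^+ 2.
  by apply: divr_gt0; [exact: mulr_gt0|exact: exprn_gt0].
have m20 : 0 < mean / 2 by rewrite divr_gt0.
have [n nB] : exists n : nat, B <= n%:R * (mean / 2).
  exists (Num.Def.trunc (B / (mean / 2))).+1; rewrite -ler_pdivrMr// ltW//.
  have Bm : 0 <= B / (mean / 2) by rewrite divr_ge0 ?(ltW m20)// /B; lra.
  by have /andP[_] := truncn_itv Bm.
have [x' [y' [x'0 y'0 u'0 ns dK]]] := atom_zero_path _ _ n x0 y0 u0.
rewrite -/K in dK.
have s0 : 0 < x' + y' by lra.
have s1 : 2 * K / r <= x' + y' by apply: le_trans ns; rewrite /B in nB; lra.
have s2 : 24 * beta / r ^+ 2 <= x' + y' by apply: le_trans ns; rewrite /B in nB; lra.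
have := atom_ge x' y' x'0 y'0; rewrite u'0 subr_le0.
apply/negP; rewrite -ltNge -[ltRHS](divfK (lt0r_neq0 (exprn_gt0 2 r0))).
rewrite ltr_pM2l ?divr_gt0 ?exprn_gt0// /square_barrier.
have -> : x' / (x' + y') - t0 = ((1 - t0) * x' - t0 * y') / (x' + y').
  by field; rewrite gt_eqF.
set D := _ / (x' + y').
have hD : `|D| <= r / 2.
  rewrite normrM (gtr0_norm (x := _^-1)) ?invr_gt0// ler_pdivrMr//.
  apply: le_trans dK _; move: s1; rewrite ler_pdivrMr//; lra.
have hD2 : D ^+ 2 <= (r / 2) ^+ 2.
  by rewrite -(real_normK (num_real D)) ler_sqr ?nnegrE// divr_ge0// ltW.
have hE : 6 * beta / (x' + y') <= r ^+ 2 / 4.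
  rewrite ler_pdivrMr//; move: s2; rewrite ler_pdivrMr ?exprn_gt0//; lra.
have : (r / 2) ^+ 2 = r ^+ 2 / 4 by field.
have : 0 < r ^+ 2 by rewrite exprn_gt0.
lra.
Qed.

End jump.

(** * The gap condition and the atoms of the averaged measure *)

Lemma Phi_of_set1 : Phi_of phi [set z] =
  (\int[lebesgue_measure]_(t in `[0%R, 1%R]) (cdfr (phi t) z - cdfl (phi t) z)%:E)%E.
Proof. by apply: eq_integral => t _; rewrite measure_set1E. Qed.

(** A violation at [t' < t] gives, by monotonicity, atoms of mass at least [c] for all parameters in
    [[t', t]], so the average charges [z] by at least [c * (t - t')]. *)
Lemma gap_of_Phi_eq0 : Phi_of phi [set z] = 0%E ->
  forall t' t, 0 <= t' -> t' < t -> t <= 1 -> cdfr (phi t) z <= cdfl (phi t') z.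
Proof.
rewrite Phi_of_set1 => Phi0 t' t t'0 t't t1; rewrite leNgt; apply/negP => lt.
have sub : `[t', t]%classic `<=` (`[0, 1]%classic : set R).
  by apply: subset_itv; rewrite bnd_simp.
have mp : measurable_fun (`[0, 1]%classic : set R)
    (fun t => (cdfr (phi t) z - cdfl (phi t) z)%:E).
  by apply/measurable_EFinP; exact: measurable_phi U z.
pose c := cdfr (phi t) z - cdfl (phi t') z.
have c0 : 0 < c by rewrite subr_gt0.
have : ((c * (t - t'))%:E <= 0)%E.
  rewrite -Phi0.
  apply: le_trans (_ : (\int[lebesgue_measure]_(r in `[t', t])
      (cdfr (phi r) z - cdfl (phi r) z)%:E <= _)%E); last first.
    apply: ge0_subset_integral => //.
    by move=> r _; rewrite lee_fin subr_ge0 cdfl_le_cdfr.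
  rewrite (_ : (c * (t - t'))%:E = (\int[lebesgue_measure]_(r in `[t', t]) c%:E)%E).
    apply: ge0_le_integral => //.
    - by move=> r _; rewrite lee_fin ltW.
    - exact: measurable_funS mp.
    - move=> r /=; rewrite in_itv/= => /andP[r1 r2]; rewrite lee_fin /c.
      have := cdfr_phi_nincr U r t z ltac:(lra) r2 t1.
      by have := cdfl_phi_nincr U t' r z t'0 r1 ltac:(lra); lra.
  have len : lebesgue_measure (`[t', t]%classic : set R) = (t - t')%:E.
    by rewrite lebesgue_measure_itv/= lte_fin t't -EFinB.
  by rewrite integral_cst// EFinM; congr (_ * _)%E; rewrite -len.
by rewrite lee_fin leNgt mulr_gt0// subr_gt0.
Qed.

(** On a grid of mesh [1/(N+1)] the gap bounds the atom on each cell by the drop of [cdfl] across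
    it. The drops telescope to at most 1, so the integral is at most [1/(N+1)]. *)
Lemma Phi_eq0_of_gap :
  (forall t' t, 0 <= t' -> t' < t -> t <= 1 -> cdfr (phi t) z <= cdfl (phi t') z) ->
  Phi_of phi [set z] = 0%E.
Proof.
move=> gap; rewrite Phi_of_set1.
pose p t : \bar R := (cdfr (phi t) z - cdfl (phi t) z)%:E.
have mp : measurable_fun (`[0, 1]%classic : set R) p.
  by apply/measurable_EFinP; exact: measurable_phi U z.
have p0 t : (0 <= p t)%E by rewrite lee_fin subr_ge0 cdfl_le_cdfr.
apply/eqP; rewrite eq_le; apply/andP; split; last first.
  by apply: integral_ge0 => t _; exact: p0.
have bound (N n : nat) : (n <= N.+1)%N ->
    (\int[lebesgue_measure]_(t in `[0%R, (n%:R / N.+1%:R)%R]) p t <=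
     (N.+1%:R^-1 * (cdfl (phi 0) z - cdfl (phi (n%:R / N.+1%:R)) z))%:E)%E.
  elim: n => [_|n IH nN].
    by rewrite mul0r set_itv1 integral_set1 subrr mulr0.
  set s := n%:R / N.+1%:R in IH *; set t := n.+1%:R / N.+1%:R.
  have N0 : 0 < N.+1%:R :> R by rewrite ltr0n.
  have s0 : 0 <= s by rewrite divr_ge0.
  have tE : t = s + N.+1%:R^-1 by rewrite /t /s -natr1 mulrDl mul1r.
  have st : s < t by rewrite tE ltrDl invr_gt0.
  have t1 : t <= 1 by rewrite ler_pdivrMr// mul1r ler_nat.
  have split_itv : `[0, t]%classic = `[0, s]%classic `|` `]s, t]%classic :> set R.
    apply/seteqP; split => u /=; rewrite !in_itv/=.
      move=> /andP[u0 ut]; have [us|us] := leP u s; first by left; rewrite u0.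
      by right; rewrite ut.
    by case=> /andP[u0 us]; apply/andP; split; lra.
  have sub : `[0, t]%classic `<=` (`[0, 1]%classic : set R).
    by apply: subset_itv; rewrite bnd_simp.
  rewrite split_itv ge0_integral_setU//; last 2 first.
  - by rewrite -split_itv; exact: measurable_funS mp.
  - rewrite disj_set2E; apply/eqP/seteqP; split => // u /= [].
    rewrite !in_itv/= => /andP[_ us] /andP[su _].
    by have := lt_le_trans su us; rewrite ltxx.
  (* The cell is open at [s] because the gap compares [s] with strictly larger parameters. *)
  have step : (\int[lebesgue_measure]_(u in `]s, t]) p u <=
      (N.+1%:R^-1 * (cdfl (phi s) z - cdfl (phi t) z))%:E)%E.
    rewrite (_ : (N.+1%:R^-1 * _)%:E = (\int[lebesgue_measure]_(r in `]s, t])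
      (cdfl (phi s) z - cdfl (phi t) z)%:E)%E); last first.
      have len : lebesgue_measure (`]s, t]%classic : set R) = (N.+1%:R^-1)%:E.
        rewrite lebesgue_measure_itv/= lte_fin st -EFinB tE.
        by rewrite addrC addKr.
      by rewrite integral_cst// mulrC EFinM; congr (_ * _)%E; rewrite -len.
    apply: ge0_le_integral => //.
    - apply: measurable_funS mp => // u us; apply: sub.
      by rewrite split_itv; right.
    - move=> u /=; rewrite in_itv/= => /andP[su ut]; rewrite lee_fin.
      have := gap s u s0 su ltac:(lra).
      by have := cdfl_phi_nincr U u t z ltac:(lra) ut t1; lra.
  apply: le_trans (leeD (IH (ltnW nN)) step) _.
  by rewrite -EFinD lee_fin -mulrDr ler_wpM2l ?invr_ge0//; lra.
apply/lee_addgt0Pr => e e0; rewrite add0e.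
have [N] := ltr_add_invr e0; rewrite add0r => Ne.
have := bound N N.+1 (leqnn _); rewrite divff// => h.
apply: le_trans h _; rewrite lee_fin; apply: le_trans (ltW Ne).
rewrite -[leRHS]mulr1 ler_wpM2l ?invr_ge0//.
have := cdfl_ge0 (phi 1) z; have := cdfl_le_cdfr (phi 0) z.
by have := cdfr_le1 (phi 0) z; lra.
Qed.

End atoms.

Theorem theorem2p3 (R : realType) (m0 beta : R) (mu nu : probability R R)
  (phi : R -> probability R R) (G : R -> R -> probability R R) :
  (* standing assumptions on (mu, nu) *)
  0 < m0 -> m0 <= beta ->
  supported_on beta mu -> supported_on beta nu ->
  (\int[mu]_k k%:E = \int[nu]_k k%:E)%E ->
  (m0%:E <= \int[mu]_k k%:E)%E ->
  (* phi : [0,1] -> P([0,1]) continuous for d_W *)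
  (forall t, 0 <= t <= 1 -> supported_on 1 (phi t)) ->
  (forall t, 0 <= t <= 1 -> forall e : R, 0 < e -> exists2 d : R, 0 < d &
     forall s, 0 <= s <= 1 -> `|s - t| < d -> (dW (phi s) (phi t) < e%:E)%E) ->
  (* phi monotonic *)
  (forall s t, 0 <= s -> s <= t -> t <= 1 -> st_le (phi s) (phi t)) ->
  (* G : S -> P([0,1]) continuous for d_W *)
  (forall x y, inS x y -> supported_on 1 (G x y)) ->
  (forall x y, inS x y -> forall e : R, 0 < e -> exists2 d : R, 0 < d &
     forall x' y', inS x' y' -> `|x' - x| < d -> `|y' - y| < d ->
       (dW (G x' y') (G x y) < e%:E)%E) ->
  (* functional equation, as an identity of signed measures *)
  (forall x y : R, inS x y -> forall B : set R, measurable B ->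
     (x%:E * (\int[mu]_(k in `[0%R, beta]) (G x y B - G (x + k)%R y B))
      + y%:E * (\int[nu]_(k in `[0%R, beta]) (G x y B - G x (y + k)%R B)) = 0)%E) ->
  (* boundary conditions *)
  (forall y, 0 < y -> forall B : set R, measurable B -> G 0 y B = phi 0 B) ->
  (forall x, 0 < x -> forall B : set R, measurable B -> G x 0 B = phi 1 B) ->
  (* behaviour at infinity *)
  (forall e : R, 0 < e -> exists M : R, forall x y, inS x y -> M < x + y ->
     (dW (G x y) (phi (x / (x + y))%R) < e%:E)%E) ->
  ((exists x0 y0, 0 < x0 /\ 0 < y0 /\ no_atoms01 (G x0 y0)) ->
      no_atoms01 (Phi_of phi))
  /\
  (no_atoms01 (Phi_of phi) ->
      forall x y, 0 < x -> 0 < y -> no_atoms01 (G x y)).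
Proof.
move=> m0_gt0 m0_beta mu1 nu1 mean_eq mean_ge phi1 phi_cont phi_mono G1 G_cont
  G_eq _ _ G_inf.
have jmu := jump_law_supported _ _ mu1.
have jnu := jump_law_supported _ _ nu1.
rewrite -mean_eq in jnu.
(* Finiteness matters because [fine] sends an infinite mean to 0, which would lose positivity. *)
have mean_fin : (\int[mu]_k k%:E < +oo)%E.
  have -> : (\int[mu]_k k%:E = \int[mu]_(k in `[0%R, beta]) k%:E)%E.
    by apply: integral_supported; move: mu1; rewrite /supported_on set_mem_set.
  have fin : (\int[mu]_(k in `[0%R, beta]) k%:E)%E \is a fin_num.
    apply: integrable_fin_num => //.
    by apply: bounded_measurable_integrable; exact: bounded_measurable_id.
  by rewrite ltey_eq fin.
have mean_gt0 : 0 < fine (\int[mu]_k k%:E)%E.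
  by apply: fine_gt0; rewrite mean_fin andbT (lt_le_trans _ mean_ge)// lte_fin.
have U : urn_solution beta (fine (\int[mu]_k k%:E)%E) mu nu phi G.
  by split => //; lra.
split.
  move=> [x0 [y0 [x0_gt0 [y0_gt0 noatom]]]] z z01.
  (* By contraposition: a failure of the gap would give a positive atom at every interior point, in
     particular at [(x0, y0)]. *)
  apply: (Phi_eq0_of_gap U) => t' t t'0 t't t1.
  rewrite leNgt; apply/negP => lt.
  have := atom_gt0_of_jump U z t' t (cdfr (phi t) z - cdfl (phi t') z) t'0 t't t1.
  rewrite subr_gt0 => /(_ lt ltac:(by rewrite addrC subrK) x0 y0 x0_gt0 y0_gt0).
  have := noatom z z01; rewrite measure_set1E => -[] u0.
  by rewrite /atom u0 ltxx.
move=> noatom x y x_gt0 y_gt0 z z01; rewrite measure_set1E; congr EFin.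
exact: (atom_eq0_of_gap U z (gap_of_Phi_eq0 U z (noatom z z01))).
Qed.
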